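(* Let $X$ and $Y$ be Banach spaces, $S\in\mathcal{L}(X,Y)$, $F\subset X$ convex and $n\in\mathbb{N}$. Then \[ \Big(\prod_{k=0}^{2n-1} e_k^{\text{det-non}}(S,F)\Big)^{1/(2n)}\;\le\;2^{7/2}\,n^{3/2}\Big(\prod_{k=0}^{n-1} e_k^{\text{ran}}(S,F)\Big)^{1/n}. \] If $F$ is additionally symmetric, or if $Y$ is a Hilbert space, the factor $n^{3/2}$ can be replaced by $n$; if $F$ is symmetric and $Y$ is a Hilbert space, it can be replaced by $n^{1/2}$.
   Context: $\mathcal{L}(X,Y)$ denotes bounded linear operators, $X'$ the dual of $X$. A deterministic adaptive algorithm with $n$ measurements is a map $A_n=\phi\circ N_n\colon F\to Y$ where $\phi\colon\mathbb{R}^n\to Y$ is arbitrary and $N_n(f)=(y_1,\dots,y_n)$ with $y_1=L_1(f)$ and $y_k=L_k^{(y_1,\dots,y_{k-1})}(f)$, where each $L_k^{(\cdot)}\in X'$ may depend arbitrarily on the previously observed values; it is non-adaptive if $L_1,\dots,L_n\in X'$ are fixed. (For $n=0$ the algorithm outputs a constant.) The worst-case error is $e(A_n,S,F)=\sup_{f\in F}\|S(f)-A_n(f)\|_Y$. A randomized algorithm is a family $(A_n^\omega)_{\omega\in\Omega}$ of deterministic adaptive algorithms indexed by a probability space $(\Omega,\mathcal{A},\mathbb{P})$ such that $(f,\omega)\mapsto\|S(f)-A_n^\omega(f)\|_Y$ is $\mathcal{B}_F\otimes\mathcal{A}$-measurable, where $\mathcal{B}_F$ is the Borel $\sigma$-algebra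 on $F$ of the seminorm whose unit ball is $F-F$; its error is $\sup_{f\in F}\mathbb{E}\|S(f)-A_n^\omega(f)\|_Y$. The minimal errors $e_n^{\text{det-non}}(S,F)$ and $e_n^{\text{ran}}(S,F)$ are the infima of the error over all deterministic non-adaptive algorithms, respectively over all randomized (possibly adaptive) algorithms, with $n$ measurements. *)

(* Defs.v *)
From HB Require Import structures.
From mathcomp Require Import all_boot all_order all_algebra.
From mathcomp Require Import all_classical all_reals all_analysis.
Set Implicit Arguments. Unset Strict Implicit. Unset Printing Implicit Defensive.
Import Order.TTheory GRing.Theory Num.Theory.
Import numFieldNormedType.Exports.
Local Open Scope classical_set_scope.
Local Open Scope ring_scope.

Definition is_linear_map (R : realType) (X Y : lmodType R) (T : X -> Y) :=
  forall (a : R) (x y : X), T (a *: x + y) = a *: T x + T y.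

Definition bounded_linear (R : realType) (X Y : normedModType R) (S : X -> Y) :=
  is_linear_map S /\ exists C : R, forall x : X, `|S x| <= C * `|x|.

Definition in_dual (R : realType) (X : normedModType R) (l : X -> R) :=
  is_linear_map (l : X -> R^o) /\ exists C : R, forall x : X, `|l x| <= C * `|x|.

Definition symmetric_set (R : realType) (X : lmodType R) (F : set X) :=
  forall x, F x -> F (- x).

Definition hilbert_norm (R : realType) (Y : normedModType R) :=
  exists ip : Y -> Y -> R,
    (forall x y, ip x y = ip y x) /\
    (forall (a : R) x y z, ip (a *: x + y) z = a * ip x z + ip y z) /\
    (forall x, `|x| ^+ 2 = ip x x).

(* Information N_n(f) = (y_1,...,y_n): with L k ys the (k+1)-th functional,
   chosen on the basis of the previously observed values ys. *)
Fixpoint info (R : realType) (X : Type) (L : nat -> seq R -> X -> R) (f : X)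
  (k : nat) : seq R :=
  match k with
  | 0 => [::]
  | k'.+1 => let ys := info L f k' in rcons ys (L k' ys f)
  end.

Definition valid_info (R : realType) (X : normedModType R) (n : nat)
  (L : nat -> seq R -> X -> R) :=
  forall k ys, (k < n)%N -> in_dual (L k ys).

Definition nonadaptive (R : realType) (X : Type) (n : nat)
  (L : nat -> seq R -> X -> R) :=
  forall k ys ys' x, (k < n)%N -> L k ys x = L k ys' x.

Definition alg_out (R : realType) (X Y : Type) (n : nat)
  (L : nat -> seq R -> X -> R) (phi : seq R -> Y) (f : X) : Y :=
  phi (info L f n).

(* sup over F of a nonnegative quantity (taken to be 0 if F is empty) *)
Definition supF (R : realType) (X : Type) (F : set X) (g : X -> \bar R) : \bar R :=
  ereal_sup ([set g f | f in F] `|` [set 0%E]).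

Definition wc_error (R : realType) (X Y : normedModType R) (S : X -> Y) (F : set X)
  (A : X -> Y) : \bar R :=
  supF F (fun f => (`|S f - A f|)%:E).

(* Minkowski functional of C (value +oo if x is in no dilate of C) *)
Definition minkowski (R : realType) (X : lmodType R) (C : set X) (x : X) : \bar R :=
  ereal_inf [set t%:E | t in [set t : R | 0 < t /\ exists c, C c /\ x = t *: c]].

Definition diff_set (R : realType) (X : lmodType R) (F : set X) : set X :=
  [set x - y | x in F & y in F].

Definition F_open (R : realType) (X : lmodType R) (F : set X) (U : set X) :=
  U `<=` F /\
  forall x, U x -> exists2 e : R, 0 < e &
    forall y, F y -> (minkowski (diff_set F) (y - x) < e%:E)%E -> U y.

Definition borel_F (R : realType) (X : lmodType R) (F : set X) : set (set X) :=
  <<s F, F_open F >>.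

Definition prod_sigma (R : realType) (X : lmodType R) (F : set X)
  (d : measure_display) (Om : measurableType d) : set (set (X * Om)) :=
  <<s F `*` [set: Om],
      [set B `*` A | B in borel_F F & A in [set A : set Om | measurable A]] >>.

Definition e_detnon (R : realType) (X Y : normedModType R) (n : nat)
  (S : X -> Y) (F : set X) : \bar R :=
  ereal_inf [set e | exists (L : nat -> seq R -> X -> R) (phi : seq R -> Y),
     [/\ valid_info n L, nonadaptive n L & e = wc_error S F (alg_out n L phi)]].

Definition e_ran (R : realType) (X Y : normedModType R) (n : nat)
  (S : X -> Y) (F : set X) : \bar R :=
  ereal_inf [set e | exists (d : measure_display) (Om : measurableType d)
     (P : probability Om R)
     (L : Om -> nat -> seq R -> X -> R) (phi : Om -> seq R -> Y),
     [/\ (forall w, valid_info n (L w)),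
         (forall B : set R, measurable B ->
            prod_sigma F ((F `*` [set: Om]) `&`
              [set p | B `|S p.1 - alg_out n (L p.2) (phi p.2) p.1| ]))
       & e = supF F (fun f =>
               (\int[P]_(w in [set: Om]) (`|S f - alg_out n (L w) (phi w) f|)%:E)%E)]].

(* Main.v *)
(** Greedily choose differences h_j = f_j - g_j of elements of F and norming
    functionals N_j of S h_j such that N_i (S h_j) = 0 for i < j and |S h_j|
    almost reaches e_j^det-non.  The matrix M = (N_i (S h_j)) is triangular, so
    the product of its singular values dominates the product of the
    deterministic errors.  By convexity F contains a translate of the image of
    a Euclidean ball of radius r under t |-> sum_j t_j h_j, on which S is
    bounded below through the singular values of M.  On a section by the
    2k+1 leading singular directions, averaging over a thin spherical shell
    bounds the error of every algorithm with k measurements from below by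
    sigma_(2k+1) r / 2 up to the factor comparing |y| with |(N_i y)_i|_2: each
    measurement can be rotated onto a coordinate axis, which costs one
    dimension, and after k of them the symmetry z |-> -z applies.
    Multiplying over k < n gives the theorem, since
    prod_(k < n) sigma_(2k+1)^2 >= prod_(j <= 2n) sigma_j.  Norming functionals
    exist by Hahn-Banach; in a Hilbert space the N_j are inner products with
    orthonormal vectors and Bessel's inequality improves the factor. *)

Require Import Defs.
From HB Require Import structures.
From mathcomp Require Import all_boot all_order all_algebra.
From mathcomp Require Import spectral complex.
From mathcomp Require Import all_classical all_reals all_analysis.
From mathcomp Require Import measurable_realfun zify ring lra.
Set Implicit Arguments. Unset Strict Implicit. Unset Printing Implicit Defensive.
Import Order.TTheory GRing.Theory Num.Theory.
Import numFieldNormedType.Exports.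
Local Open Scope classical_set_scope.
Local Open Scope ring_scope.

(** * Measure-preserving maps: translations, shears and plane rotations *)

(** Invariance is phrased through integrals of nonnegative functions, the form in which it passes
    through Tonelli's theorem and is applied to error integrals. *)
Definition measure_preserving d (T : measurableType d) (R : realType)
    (mu : set T -> \bar R) (Q : T -> T) :=
  measurable_fun [set: T] Q /\
  forall f : T -> \bar R, measurable_fun [set: T] f -> (forall x, (0 <= f x)%E) ->
    (\int[mu]_x f (Q x) = \int[mu]_x f x)%E.

Section measure_preserving_maps.
Local Open Scope ereal_scope.
Context (R : realType).
Local Notation leb := (@lebesgue_measure R).

Lemma measure_preserving_id d (T : measurableType d) (mu : set T -> \bar R) :
  measure_preserving mu id.
Proof. by split. Qed.

Lemma measure_preserving_comp d (T : measurableType d) (mu : set T -> \bar R)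
    (P Q : T -> T) :
  measure_preserving mu P -> measure_preserving mu Q ->
  measure_preserving mu (fun x => P (Q x)).
Proof.
move=> [mP iP] [mQ iQ]; split; first exact: measurableT_comp mP mQ.
move=> f mf f0; rewrite (iQ (fun x => f (P x)))//; last exact: measurableT_comp mf mP.
exact: iP.
Qed.

Lemma measure_preserving_pushforward d (T : measurableType d)
    (mu : {measure set T -> \bar R}) (Q : T -> T) :
  measurable_fun [set: T] Q ->
  (forall A, measurable A -> mu (Q @^-1` A) = mu A) -> measure_preserving mu Q.
Proof.
move=> mQ pQ; split => // f mf f0.
have := @ge0_integral_pushforward _ _ _ _ R Q mQ mu _ f measurableT.
rewrite preimage_setT => <- //.
apply: eq_measure_integral => A mA _. exact: pQ.
Qed.

(** Uniqueness of Lebesgue measure: the pushforward agrees with it on half-open intervals. *)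
Lemma measure_preserving_add (a : R) :
  @measure_preserving _ (measurableTypeR R) R leb (fun x => x + a)%R.
Proof.
have ma : measurable_fun [set: measurableTypeR R]
    (fun x : measurableTypeR R => (x + a)%R : measurableTypeR R).
  exact: measurable_funD.
apply: measure_preserving_pushforward => // A mA.
apply/esym; move: A mA.
apply: (@lebesgue_measure_unique R (pushforward leb (fun x : measurableTypeR R => (x + a)%R : measurableTypeR R))) => _ [[u v]] _ <-.
transitivity (leb `](u - a)%R, (v - a)%R]%classic).
  rewrite !lebesgue_measure_itv/= !lte_fin ltrD2r; case: ifP => // _.
  by rewrite -!EFinB; congr EFin; ring.
rewrite /pushforward; congr (leb _).
by apply/seteqP; split => x /=; rewrite !in_itv/= ltrBlDr lerBrDr.
Qed.

Lemma measure_preserving_opp :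
  @measure_preserving _ (measurableTypeR R) R leb (fun x => - x)%R.
Proof.
apply: measure_preserving_pushforward => [|A mA]; first exact: oppr_measurable.
exact: (@lebesgue_measureN R A mA).
Qed.

Section products.
Context d1 d2 (T1 : measurableType d1) (T2 : measurableType d2).
Variable m1 : {sigma_finite_measure set T1 -> \bar R}.
Variable m2 : {sigma_finite_measure set T2 -> \bar R}.

Definition sigma_finite_prod_fun : set (T1 * T2)%type -> \bar R := m1 \x m2.

HB.instance Definition _ := Measure.copy sigma_finite_prod_fun (m1 \x m2).

Let sigma_finite_prod_subproof : sigma_finite setT sigma_finite_prod_fun.
Proof.
have /sigma_finiteP[A [TA ndA Aoo]] := sigma_finiteT m1.
have /sigma_finiteP[B [TB ndB Boo]] := sigma_finiteT m2.
exists (fun n => A n `*` B n).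
  apply/seteqP; split => // -[x y] _.
  have [[i _ Aix] [j _ Bjy]] : (\bigcup_i A i) x /\ (\bigcup_i B i) y.
    by rewrite -TA -TB.
  exists (maxn i j) => //; split => /=.
    by move: x Aix; exact/subsetPset/ndA/leq_maxl.
  by move: y Bjy; exact/subsetPset/ndB/leq_maxr.
move=> k; have [? ?] := Aoo k; have [? ?] := Boo k.
split; first exact: measurableX.
by rewrite /sigma_finite_prod_fun product_measure1E// lte_mul_pinfty// ge0_fin_numE.
Qed.

HB.instance Definition _ :=
  Measure_isSigmaFinite.Build _ _ _ sigma_finite_prod_fun sigma_finite_prod_subproof.

(* The sigma-finite instance that the library attaches to [m1 \x m2] only
   applies to subprobabilities. *)
Definition sigma_finite_prod : {sigma_finite_measure set (T1 * T2)%type -> \bar R} :=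
  sigma_finite_prod_fun.

Lemma tonelli1 (f : T1 * T2 -> \bar R) :
  measurable_fun setT f -> (forall z, 0 <= f z) ->
  \int[sigma_finite_prod]_z f z = \int[m1]_x \int[m2]_y f (x, y).
Proof. exact: fubini_tonelli1. Qed.

Lemma tonelli2 (f : T1 * T2 -> \bar R) :
  measurable_fun setT f -> (forall z, 0 <= f z) ->
  \int[sigma_finite_prod]_z f z = \int[m2]_y \int[m1]_x f (x, y).
Proof. exact: fubini_tonelli2. Qed.

(** Integrating the moved coordinate innermost reduces the claim to the single fibres. *)
Lemma measure_preserving_fiber1 (Q : T1 -> T2 -> T2) :
  measurable_fun [set: T1 * T2] (fun z => Q z.1 z.2) ->
  (forall x, measure_preserving m2 (Q x)) ->
  measure_preserving sigma_finite_prod (fun z => (z.1, Q z.1 z.2)).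
Proof.
move=> mQ pQ.
have mG : measurable_fun setT (fun z : T1 * T2 => (z.1, Q z.1 z.2)).
  by apply: measurable_fun_pair.
split=> // f mf f0.
rewrite (@tonelli1 (fun z => f (z.1, Q z.1 z.2)))//; last first.
  exact: measurableT_comp mf mG.
rewrite (tonelli1 mf)//; apply: eq_integral => x _.
apply: (proj2 (pQ x) (fun y => f (x, y))) => //.
exact: measurableT_comp mf (pair1_measurable x).
Qed.

Lemma measure_preserving_fiber2 (Q : T2 -> T1 -> T1) :
  measurable_fun [set: T1 * T2] (fun z => Q z.2 z.1) ->
  (forall y, measure_preserving m1 (Q y)) ->
  measure_preserving sigma_finite_prod (fun z => (Q z.2 z.1, z.2)).
Proof.
move=> mQ pQ.
have mG : measurable_fun setT (fun z : T1 * T2 => (Q z.2 z.1, z.2)).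
  by apply: measurable_fun_pair.
split=> // f mf f0.
rewrite (@tonelli2 (fun z => f (Q z.2 z.1, z.2)))//; last first.
  exact: measurableT_comp mf mG.
rewrite (tonelli2 mf)//; apply: eq_integral => y _.
apply: (proj2 (pQ y) (fun x => f (x, y))) => //.
exact: measurableT_comp mf (pair2_measurable y).
Qed.

End products.

Section plane_rotation.
Context d (T : measurableType d) (mu : {sigma_finite_measure set T -> \bar R}).
Local Notation RT := (measurableTypeR R * T)%type.
Local Notation RRT := (measurableTypeR R * (measurableTypeR R * T))%type.
Local Notation m2 := (sigma_finite_prod leb mu).
Local Notation m3 := (sigma_finite_prod leb m2).

Lemma measure_preserving_shear1 (a : R) :
  @measure_preserving _ RRT R m3 (fun z => (z.1 + a * z.2.1, z.2))%R.
Proof.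
apply: (@measure_preserving_fiber2 _ _ _ _ leb m2
  (fun (u : RT) (x : measurableTypeR R) => (x + a * u.1)%R : measurableTypeR R)) => /=.
  apply: measurable_funD => //; apply: measurable_funM => //.
  exact: measurableT_comp.
by move=> u; exact: measure_preserving_add.
Qed.

Lemma measure_preserving_shear2 (a : R) :
  @measure_preserving _ RRT R m3 (fun z => (z.1, (z.2.1 + a * z.1, z.2.2)))%R.
Proof.
apply: (@measure_preserving_fiber1 _ _ _ _ leb m2
  (fun (x : measurableTypeR R) (u : RT) => ((u.1 + a * x)%R : measurableTypeR R, u.2))) => /=.
  apply: measurable_fun_pair => /=; last exact: measurableT_comp.
  apply: measurable_funD => //; last exact: measurable_funM.
  exact: measurableT_comp.
move=> x.
apply: (@measure_preserving_fiber2 _ _ _ _ leb mu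
  (fun (u : T) (y : measurableTypeR R) => (y + a * x)%R : measurableTypeR R)) => /=.
  by apply: measurable_funD.
by move=> u; exact: measure_preserving_add.
Qed.

(* A plane rotation with nonzero sine is a product of three shears. *)
Lemma measure_preserving_rotation (c s : R) : (s != 0)%R ->
  (c ^+ 2 + s ^+ 2 = 1)%R ->
  @measure_preserving _ RRT R m3
    (fun z => (c * z.1 - s * z.2.1, (s * z.1 + c * z.2.1, z.2.2)))%R.
Proof.
(* For the angle with cosine [c] and sine [s] this is minus the tangent of half the angle; the
   shears by [a], [s], [a] compose to the rotation. *)
move=> s0 cs1; pose a := ((c - 1) / s)%R.
have := measure_preserving_comp (measure_preserving_shear1 a)
  (measure_preserving_comp (measure_preserving_shear2 s) (measure_preserving_shear1 a)).
have sa : (s * a = c - 1)%R by rewrite /a mulrC divfK.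
have ac : (a * (c + 1) = - s)%R.
  apply: (mulfI s0); rewrite mulrA sa; apply/eqP; rewrite -subr_eq0; apply/eqP.
  have -> : ((c - 1) * (c + 1) - s * - s = c ^+ 2 + s ^+ 2 - 1)%R by ring.
  by rewrite cs1 subrr.
congr measure_preserving; apply/funext => -[x [y u]] /=.
congr (_, (_, _))%R.
  transitivity (x * (1 + s * a) + y * (a * (s * a + 2)))%R; first by ring.
  have -> : (s * a + 2 = c + 1)%R by rewrite sa; ring.
  by rewrite ac sa; ring.
transitivity (s * x + y * (1 + s * a))%R; first by ring.
by rewrite sa; ring.
Qed.

End plane_rotation.

End measure_preserving_maps.

(** * Euclidean space as an iterated product and its radial integrals *)

(** Bundling a space with its measure lets [euclid] build both in one recursion. *)
Record sf_space (R : realType) := SfSpace {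
  sf_display : measure_display;
  sf_type : measurableType sf_display;
  sf_measure : {sigma_finite_measure set sf_type -> \bar R} }.

(* R^d with its Lebesgue measure, as the iterated product R x (R x ... (R x unit)). *)
Fixpoint euclid (R : realType) (d : nat) : sf_space R :=
  match d with
  | 0 => SfSpace [the {sigma_finite_measure set unit -> \bar R} of dirac tt]
  | d'.+1 => SfSpace (sigma_finite_prod (@lebesgue_measure R) (sf_measure (euclid R d')))
  end.

Definition pt (R : realType) (d : nat) := sf_type (euclid R d).
Definition vol (R : realType) (d : nat) : {sigma_finite_measure set (pt R d) -> \bar R} :=
  sf_measure (euclid R d).

(** The vectors are indexed by all of [nat], so that passing to the tail of [z] is a shift of
    [w]. *)
Fixpoint comb (R : realType) (V : lmodType R) (d : nat) : pt R d -> (nat -> V) -> V :=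
  match d return pt R d -> (nat -> V) -> V with
  | 0 => fun _ _ => 0
  | d'.+1 => fun z w => z.1 *: w 0%N + comb z.2 (fun i => w i.+1)
  end.

Fixpoint normsq (R : realType) (d : nat) : pt R d -> R :=
  match d return pt R d -> R with
  | 0 => fun _ => 0
  | d'.+1 => fun z => z.1 ^+ 2 + normsq z.2
  end.

Section euclid.
Context (R : realType).
Local Notation leb := (@lebesgue_measure R).

Lemma tonelli_pt d (f : pt R d.+1 -> \bar R) :
  measurable_fun [set: pt R d.+1] f -> (forall z, (0 <= f z)%E) ->
  (\int[vol R d.+1]_z f z = \int[leb]_x \int[vol R d]_u f (x, u))%E.
Proof. exact: tonelli1. Qed.

Lemma measurable_section_pt d (f : pt R d.+1 -> \bar R) :
  measurable_fun [set: pt R d.+1] f -> (forall z, (0 <= f z)%E) ->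
  measurable_fun [set: measurableTypeR R] (fun x => \int[vol R d]_u f (x, u))%E.
Proof. by move=> mf f0; apply: measurable_fun_fubini_tonelli_F. Qed.

Lemma normsq_ge0 d (z : pt R d) : 0 <= normsq z.
Proof. by elim: d z => //= d IH [x z]; rewrite addr_ge0 ?sqr_ge0. Qed.

Lemma measurable_normsq d : measurable_fun [set: pt R d] (@normsq R d).
Proof.
elim: d => [|d IH] /=; first exact: measurable_cst.
apply: measurable_funD; first by apply: measurable_funX; exact: measurable_fst.
by apply: measurableT_comp IH measurable_snd.
Qed.

Lemma eq_comb (V : lmodType R) d (z : pt R d) (w w' : nat -> V) :
  (forall i, (i < d)%N -> w i = w' i) -> comb z w = comb z w'.
Proof.
elim: d z w w' => //= d IH z w w' ww'.
by rewrite ww'// (IH z.2 _ (fun i => w' i.+1))// => i id; rewrite ww'.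
Qed.

Lemma comb_linear (V W : lmodType R) (l : V -> W) d (z : pt R d) (w : nat -> V) :
  is_linear_map l -> l (comb z w) = comb z (l \o w).
Proof.
move=> ll; have l0 : l 0 = 0.
  by have := ll (-1) 0 0; rewrite scaler0 addr0 scaleN1r addNr.
by elim: d z w => [|d IH] z w //=; rewrite ll IH.
Qed.

Fixpoint popp d : pt R d -> pt R d :=
  match d return pt R d -> pt R d with
  | 0 => id
  | d'.+1 => fun z => (- z.1, popp z.2)
  end.

Lemma normsq_popp d (z : pt R d) : normsq (popp z) = normsq z.
Proof. by elim: d z => //= d IH z; rewrite sqrrN IH. Qed.

Lemma comb_popp (V : lmodType R) d (z : pt R d) (w : nat -> V) :
  comb (popp z) w = - comb z w.
Proof.
by elim: d z w => [|d IH] z w /=; rewrite ?oppr0// IH scaleNr opprD.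
Qed.

Lemma measure_preserving_popp d : measure_preserving (vol R d) (@popp d).
Proof.
elim: d => [|d IH]; first exact: measure_preserving_id.
have h1 := @measure_preserving_fiber2 R _ _ (measurableTypeR R) (pt R d) leb (vol R d)
   (fun _ x => - x).
have h2 := @measure_preserving_fiber1 R _ _ (measurableTypeR R) (pt R d) leb (vol R d)
   (fun _ u => popp u).
apply: (measure_preserving_comp (h1 _ _) (h2 _ _)).
- by apply: measurableT_comp measurable_fst; exact: oppr_measurable.
- by move=> _; exact: measure_preserving_opp.
- by apply: measurableT_comp measurable_snd; exact: IH.1.
- by [].
Qed.

(** Under a radial density every coordinate carries an equal share of the second moment of the norm.
    The density is a function of the squared norm, so that slices at a fixed first coordinate are
    radial again. *)
Definition second_moment d (rho : R -> R) :=
  (d.+1%:R%:E * \int[vol R d.+1]_z (rho (normsq z) * z.1 ^+ 2)%:E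
   = \int[vol R d.+1]_z (rho (normsq z) * normsq z)%:E)%E.

Section radial.
Variables (d : nat) (rho : R -> R).
Hypotheses (mrho : measurable_fun setT rho) (rho0 : forall s, 0 <= rho s).

Lemma measurable_radial e : measurable_fun [set: pt R e] (fun z => rho (normsq z)).
Proof. exact: measurableT_comp mrho (@measurable_normsq e). Qed.

Let m1 : measurable_fun [set: pt R d.+2] (fun z => (rho (normsq z) * z.1 ^+ 2)%:E).
Proof.
apply/measurable_EFinP; apply: measurable_funM; first exact: measurable_radial.
by apply: measurable_funX; exact: measurable_fst.
Qed.

Let m2 : measurable_fun [set: pt R d.+2] (fun z => (rho (normsq z) * z.2.1 ^+ 2)%:E).
Proof.
apply/measurable_EFinP; apply: measurable_funM; first exact: measurable_radial.
by apply: measurable_funX; exact: (measurableT_comp measurable_fst measurable_snd).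
Qed.

Let m3 : measurable_fun [set: pt R d.+2]
  (fun z => (rho (normsq z) * @normsq R d.+1 z.2)%:E).
Proof.
apply/measurable_EFinP; apply: measurable_funM; first exact: measurable_radial.
exact: (measurableT_comp (@measurable_normsq d.+1) measurable_snd).
Qed.

(** Fixing the first coordinate leaves a radial density in one dimension less. There the hypothesis
    trades the norm of the tail for the first coordinate of the tail, which a quarter turn exchanges
    with [z.1]. *)
Lemma tail_moment : (forall rho : R -> R, measurable_fun setT rho -> (forall s, 0 <= rho s) ->
    second_moment d rho) ->
  (\int[vol R d.+2]_z (rho (normsq z) * @normsq R d.+1 z.2)%:E =
   d.+1%:R%:E * \int[vol R d.+2]_z (rho (normsq z) * z.1 ^+ 2)%:E)%E.
Proof.
move=> IH.
have turn : (\int[vol R d.+2]_z (rho (normsq z) * z.2.1 ^+ 2)%:E =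
             \int[vol R d.+2]_z (rho (normsq z) * z.1 ^+ 2)%:E)%E.
  (* Cosine 0 and sine 1: the quarter turn of the first two coordinates. *)
  have [|_ /(_ _ m2)] := @measure_preserving_rotation R _ (pt R d) (vol R d) 0 1
    (oner_neq0 _).
    by rewrite expr0n expr1n add0r.
  move=> E; rewrite -[LHS]E => [|z]; last by rewrite lee_fin mulr_ge0// sqr_ge0.
  by apply: eq_integral => -[x [y u]] _ /=; congr (rho _ * _)%:E; ring.
rewrite -turn (tonelli_pt m2); last first.
  by move=> z; rewrite lee_fin mulr_ge0// sqr_ge0.
rewrite (tonelli_pt m3); last first.
  by move=> z; rewrite lee_fin mulr_ge0// normsq_ge0.
rewrite -ge0_integralZl//; last 2 first.
- apply: (measurable_section_pt m2).
  by move=> z; rewrite lee_fin mulr_ge0// sqr_ge0.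
- by move=> x _; apply: integral_ge0 => y _; rewrite lee_fin mulr_ge0// sqr_ge0.
apply: eq_integral => x _.
rewrite -(IH (fun s => rho (x ^+ 2 + s)))//.
apply: measurableT_comp mrho _; exact: measurable_funD.
Qed.

Let split_moment :
  (\int[vol R d.+2]_z (rho (normsq z) * normsq z)%:E =
   \int[vol R d.+2]_z (rho (normsq z) * z.1 ^+ 2)%:E +
   \int[vol R d.+2]_z (rho (normsq z) * @normsq R d.+1 z.2)%:E)%E.
Proof.
rewrite -ge0_integralD//.
- by apply: eq_integral => z _; rewrite -EFinD -mulrDr.
- by move=> z _; rewrite lee_fin mulr_ge0// sqr_ge0.
- by move=> z _; rewrite lee_fin mulr_ge0// normsq_ge0.
Qed.

Lemma second_moment_step : (forall rho : R -> R, measurable_fun setT rho ->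
  (forall s, 0 <= rho s) -> second_moment d rho) -> second_moment d.+1 rho.
Proof.
move=> /tail_moment E; rewrite /second_moment split_moment E.
by rewrite -[X in (X + _)%E]mul1e -ge0_muleDl ?lee_fin.
Qed.

End radial.

Lemma radial_second_moment d (rho : R -> R) :
  measurable_fun setT rho -> (forall s, 0 <= rho s) ->
  (d.+1%:R%:E * \int[vol R d.+1]_z (rho (normsq z) * z.1 ^+ 2)%:E
   = \int[vol R d.+1]_z (rho (normsq z) * normsq z)%:E)%E.
Proof.
elim: d rho => [|d IH] rho mrho rho0.
  by rewrite mul1e; apply: eq_integral => z _ /=; rewrite addr0.
exact: second_moment_step.
Qed.

Lemma radial_tail_moment d (rho : R -> R) :
  measurable_fun setT rho -> (forall s, 0 <= rho s) ->
  (\int[vol R d.+2]_z (rho (normsq z) * @normsq R d.+1 z.2)%:E =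
   d.+1%:R%:E * \int[vol R d.+2]_z (rho (normsq z) * z.1 ^+ 2)%:E)%E.
Proof. by move=> mrho rho0; apply: tail_moment => //; exact: radial_second_moment. Qed.

End euclid.

(** * Averaged errors of adaptive algorithms *)

Section adaptive.
Context (R : realType).
Local Notation leb := (@lebesgue_measure R).

Lemma comb_cons (V : lmodType R) d (z : pt R d.+1) (w : nat -> V) :
  comb z w = z.1 *: w 0%N + @comb R V d z.2 (fun i => w i.+1).
Proof. by []. Qed.

Lemma normsq_cons d (z : pt R d.+1) : normsq z = z.1 ^+ 2 + @normsq R d z.2.
Proof. by []. Qed.

(** Induction on the dimension: the tail is rotated until [l] is nonzero at most on its first
    vector, and a rotation of the first two coordinates then moves that value into [w' 0]. *)
Lemma rotate_functional (V : lmodType R) (l : V -> R) :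
  is_linear_map (l : V -> R^o) -> forall d (w : nat -> V),
  exists (Q : pt R d -> pt R d) (w' : nat -> V),
  [/\ measure_preserving (vol R d) Q, (forall z, normsq (Q z) = normsq z),
      (forall z, comb (Q z) w = comb z w')
    & forall i, (0 < i < d)%N -> l (w' i) = 0].
Proof.
move=> ll; have lD x y : l (x + y) = l x + l y.
  by have := ll 1 x y; rewrite !scale1r.
have l0 : l 0 = 0.
  by have := ll (-1) 0 0; rewrite scaler0 addr0 scaleN1r addNr.
have lZ a x : l (a *: x) = a * l x by have := ll a x 0; rewrite l0 !addr0.
case => [|d] w.
  by exists id, w; split => [||| [|[|i]]] //; exact: measure_preserving_id.
elim: d w => [|d IH] w.
  by exists id, w; split => [||| [|[|i]]] //; exact: measure_preserving_id.
have [Q1 [w1 [pQ1 nQ1 cQ1 lQ1]]] := IH (fun i => w i.+1).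
pose H (z : pt R d.+2) : pt R d.+2 := (z.1, Q1 z.2).
have pH : measure_preserving (vol R d.+2) H.
  apply: (@measure_preserving_fiber1 R _ _ (measurableTypeR R) (pt R d.+1) leb
    (vol R d.+1) (fun _ u => Q1 u)) => //.
  by apply: measurableT_comp measurable_snd; exact: pQ1.1.
have nH z : normsq (H z) = normsq z by rewrite normsq_cons nQ1.
pose v i := if i is j.+1 then w1 j else w 0%N.
have cH z : comb (H z) w = comb z v by rewrite comb_cons cQ1.
(* If [b] vanishes, [H] already works; [measure_preserving_rotation] requires a nonzero sine. *)
have [b0|b0] := eqVneq (l (w1 0%N)) 0.
  by exists H, v; split => // -[//|[|i]]//= id; exact: lQ1.
set a := l (w 0%N); set b := l (w1 0%N) in b0.
have ab0 : 0 < a ^+ 2 + b ^+ 2 by rewrite ltr_wpDl ?sqr_ge0// exprn_even_gt0.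
pose p := Num.sqrt (a ^+ 2 + b ^+ 2).
have p0 : p != 0 by rewrite gt_eqF// sqrtr_gt0.
have p2 : p ^+ 2 = a ^+ 2 + b ^+ 2 by rewrite sqr_sqrtr// ltW.
(* The unit vector along [(a, b)]: the combination with coefficients [- s] and [c] is then
   annihilated by [l]. *)
pose c := a / p; pose s := b / p.
have s0 : s != 0 by rewrite mulf_neq0// invr_eq0.
have cs1 : c ^+ 2 + s ^+ 2 = 1.
  by rewrite !expr_div_n -mulrDl -p2 divff// expf_neq0.
have pG := @measure_preserving_rotation R _ (pt R d) (vol R d) c s s0 cs1.
set G := (fun z => _) in pG.
exists (fun z => H (G z)), (fun i => match i with
  | 0 => c *: w 0%N + s *: w1 0%N
  | 1 => - s *: w 0%N + c *: w1 0%N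
  | j.+2 => w1 j.+1 end); split.
- exact: measure_preserving_comp pH pG.
- move=> [x [y u]]; rewrite nH !normsq_cons /=.
  transitivity ((c ^+ 2 + s ^+ 2) * (x ^+ 2 + y ^+ 2) + normsq u); first by ring.
  by rewrite cs1; ring.
- move=> [x [y u]]; rewrite cH !comb_cons /= !addrA; congr (_ + _).
  rewrite [in LHS]scalerDl [in LHS]scalerDl addrACA !scalerDr !scalerA.
  by congr (_ + _ + (_ + _)); congr (_ *: _); ring.
- case=> [//|[|i]] id /=; last exact: lQ1.
  by rewrite lD !lZ -/a -/b mulNr /c /s (mulrAC b) (mulrAC a) (mulrC b a) addNr.
Qed.

Lemma info_cons (X : Type) (L : nat -> seq R -> X -> R) (f : X) k :
  info L f k.+1 =
  L 0%N [::] f :: info (fun j ys => L j.+1 (L 0%N [::] f :: ys)) f k.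
Proof.
elim: k => // k IH.
have -> : info L f k.+2 = rcons (info L f k.+1) (L k.+1 (info L f k.+1) f) by [].
by rewrite IH.
Qed.

(** For inputs sharing the first answer [y], what remains is a single algorithm with one measurement
    fewer; [adaptive_average] inducts on this. *)
Lemma alg_out_cons (X Y : Type) (L : nat -> seq R -> X -> R) (phi : seq R -> Y)
    (f : X) k (y := L 0%N [::] f) :
  alg_out k.+1 L phi f =
  alg_out k (fun j ys => L j.+1 (y :: ys)) (fun ys => phi (y :: ys)) f.
Proof. by rewrite /alg_out info_cons. Qed.

Section lower_average.
Context (X Y : normedModType R) (S : X -> Y) (sigma r : R).
Hypotheses (linS : is_linear_map S) (sigma_ge0 : 0 <= sigma) (r_gt0 : 0 < r).

Lemma additive_S x y : S (x + y) = S x + S y.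
Proof. by have := linS 1 x y; rewrite !scale1r. Qed.

Definition weighted_error k d (b : X) (w : nat -> X) (L : nat -> seq R -> X -> R)
    (phi : seq R -> Y) (rho : R -> R) (z : pt R d) : R :=
  rho (normsq z) * `|S (b + comb z w) - alg_out k L phi (b + comb z w)|.

(* Averaging the errors at z and -z. *)
Lemma constant_average d (b : X) (w : nat -> X) (c : Y) (rho : R -> R) :
  measurable_fun setT rho -> (forall s, 0 <= rho s) ->
  (forall s, r ^+ 2 < s -> rho s = 0) ->
  (forall z : pt R d, sigma * Num.sqrt (normsq z) <= `|S (comb z w)|) ->
  measurable_fun [set: pt R d] (fun z => rho (normsq z) * `|S (b + comb z w) - c|) ->
  ((sigma / r)%:E * \int[vol R d]_z (rho (normsq z) * normsq z)%:E <=
   \int[vol R d]_z (rho (normsq z) * `|S (b + comb z w) - c|)%:E)%E.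
Proof.
move=> mrho rho0 supp lowS mg; set g := fun z => _ in mg.
have g0 z : 0 <= g z by rewrite mulr_ge0.
have [mp ip] := @measure_preserving_popp R d.
have mEg : measurable_fun [set: pt R d] (fun z => (g z)%:E) by exact/measurable_EFinP.
have mEgp : measurable_fun [set: pt R d] (fun z => (g (popp z))%:E).
  exact: measurableT_comp mEg mp.
have mq : measurable_fun [set: pt R d] (fun z => (rho (normsq z) * normsq z)%:E).
  apply/measurable_EFinP/measurable_funM; last exact: measurable_normsq.
  exact: measurable_radial.
rewrite -(@lee_pmul2l _ 2%:E)//.
have -> : (2%:E * \int[vol R d]_z (g z)%:E = \int[vol R d]_z (g z + g (popp z))%:E)%E.
  under [RHS]eq_integral do rewrite EFinD.
  rewrite ge0_integralD//; try by move=> z _; rewrite lee_fin.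
  rewrite (ip (fun z => (g z)%:E))//.
  by rewrite -[X in (X + _)%E]mul1e -[X in (_ + X)%E]mul1e -ge0_muleDl ?lee_fin.
rewrite muleA -EFinM -ge0_integralZl//; last 2 first.
- by move=> z _; rewrite lee_fin mulr_ge0// normsq_ge0.
- by rewrite lee_fin mulr_ge0// divr_ge0// ltW.
apply: ge0_le_integral => //.
- move=> z _; rewrite -EFinM lee_fin !mulr_ge0 ?normsq_ge0//.
  by rewrite invr_ge0 ltW.
- exact: measurable_funeM.
- apply/measurable_EFinP; apply: measurable_funD; exact/measurable_EFinP.
move=> z _; rewrite -EFinM lee_fin /g normsq_popp -mulrDr.
have [/supp ->|zr] := ltP (r ^+ 2) (normsq z); first by rewrite !mul0r mulr0.
rewrite mulrCA ler_wpM2l//.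
have -> : 2 * (sigma / r) * normsq z = 2 * (sigma * (normsq z / r)).
  by rewrite -!mulrA [r^-1 * _]mulrC.
(* On the support of [rho] the norm of [z] is at most [r], so [normsq z / r] is at most this
   norm. *)
apply: (@le_trans _ _ (2 * `|S (comb z w)|)).
  rewrite ler_pM2l//; apply: le_trans (lowS z); rewrite ler_wpM2l// ler_pdivrMr//.
  rewrite -[X in X <= _]sqr_sqrtr ?normsq_ge0// expr2 ler_wpM2l ?sqrtr_ge0//.
  by rewrite -[leRHS]gtr0_norm// -sqrtr_sqr ler_wsqrtr.
rewrite comb_popp !additive_S.
have -> : 2 * `|S (comb z w)| = `|(S b + S (comb z w) - c) - (S b + S (- comb z w) - c)|.
  have -> : S (- comb z w) = - S (comb z w).
    apply/eqP; rewrite -addr_eq0 -additive_S addNr.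
    by have := linS (-1) 0 0; rewrite scaler0 addr0 scaleN1r addNr => ->.
  rewrite (_ : _ - _ = S (comb z w) *+ 2).
    by rewrite normrMn mulr_natl.
  have E (u v t : Y) : u + v - t - (u - v - t) = v *+ 2.
    by rewrite [u - v - t]addrAC [u + v - t]addrAC opprB [LHS]addrC addrA subrK mulr2n.
  exact: E.
exact: ler_normB.
Qed.

(** Induction on [k]. After a rotation the first functional varies with the first coordinate only,
    so its answer is constant on each slice, and the induction hypothesis handles the other
    measurements in one dimension less. The factor [(d - k) / d] is the share of the second moment
    in the [d - k] coordinates left after [k] such steps. *)
Theorem adaptive_average k : forall d (b : X) (w : nat -> X)
    (L : nat -> seq R -> X -> R) (phi : seq R -> Y) (rho : R -> R), (k < d)%N ->
  measurable_fun setT rho -> (forall s, 0 <= rho s) ->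
  (forall s, r ^+ 2 < s -> rho s = 0) ->
  (forall z : pt R d, sigma * Num.sqrt (normsq z) <= `|S (comb z w)|) ->
  valid_info k L ->
  measurable_fun [set: pt R d] (weighted_error k b w L phi rho) ->
  ((sigma / r * (d - k)%:R)%:E * \int[vol R d]_z (rho (normsq z) * normsq z)%:E <=
   d%:R%:E * \int[vol R d]_z (weighted_error k b w L phi rho z)%:E)%E.
Proof.
elim: k => [|k IH] d b w L phi rho kd mrho rho0 supp lowS vL mg.
  have := @constant_average d b w (phi [::]) rho mrho rho0 supp lowS mg.
  move=> h; rewrite subn0 mulrC EFinM -muleA.
  by apply: lee_wpmul2l => //; rewrite lee_fin.
case: d kd w lowS mg => // d kd w lowS mg.
have [lin0 _] : in_dual (L 0%N [::]) by exact: vL.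
have [Q [w' [pQ nQ cQ lQ]]] := rotate_functional lin0 d.+1 w.
set g := weighted_error k.+1 b w L phi rho in mg *.
pose g' := weighted_error k.+1 b w' L phi rho : pt R d.+1 -> R.
have gE z : g (Q z) = g' z by rewrite /g /g' /weighted_error nQ cQ.
have g'0 z : 0 <= g' z by rewrite mulr_ge0.
have mEg' : measurable_fun [set: pt R d.+1] (fun z => (g' z)%:E).
  apply/measurable_EFinP.
  have -> : g' = g \o Q by apply/funext => z; rewrite /= gE.
  exact: measurableT_comp mg pQ.1.
have -> : (\int[vol R d.+1]_z (g z)%:E = \int[vol R d.+1]_z (g' z)%:E)%E.
  rewrite -(pQ.2 (fun z => (g z)%:E)).
  - by apply: eq_integral => z _; rewrite gE.
  - exact/measurable_EFinP.
  - by move=> z; rewrite lee_fin mulr_ge0.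
case: d kd => [//|d] kd in Q w w' lowS pQ nQ cQ lQ g mg g' gE g'0 mEg' *.
(* The full second moment is [d.+2] times that of [z.1]; the tail moment, used for the slices, is
   [d.+1] times it. *)
rewrite subSS -radial_second_moment//.
have mtail : measurable_fun [set: pt R d.+2]
    (fun z => (rho (normsq z) * @normsq R d.+1 z.2)%:E).
  apply/measurable_EFinP; apply: measurable_funM; first exact: measurable_radial.
  exact: (measurableT_comp (@measurable_normsq R d.+1) measurable_snd).
have tail0 (z : pt R d.+2) : 0 <= rho (normsq z) * @normsq R d.+1 z.2.
  by rewrite mulr_ge0// normsq_ge0.
have slice : ((sigma / r * (d.+1 - k)%:R)%:E *
    \int[vol R d.+2]_z (rho (normsq z) * @normsq R d.+1 z.2)%:E <=
    d.+1%:R%:E * \int[vol R d.+2]_z (g' z)%:E)%E.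
  have c0 : 0 <= sigma / r * (d.+1 - k)%:R.
    by rewrite mulr_ge0// mulr_ge0// invr_ge0 ltW.
  have ms1 := measurable_section_pt mtail (fun z => tail0 z).
  have ms2 := measurable_section_pt mEg' (fun z => g'0 z).
  rewrite (tonelli_pt mtail)// (tonelli_pt mEg')//.
  rewrite -!ge0_integralZl//; last first.
  - by move=> x _; apply: integral_ge0 => u _; rewrite lee_fin.
  - by move=> x _; apply: integral_ge0 => u _; rewrite lee_fin.
  apply: ge0_le_integral => //.
  - move=> x _; apply: mule_ge0; first by rewrite lee_fin.
    by apply: integral_ge0 => u _; rewrite lee_fin.
  - exact: measurable_funeM.
  - exact: measurable_funeM.
  move=> x _.
  pose b' := b + x *: w' 0%N; pose y := L 0%N [::] b'.
  pose rhox s := rho (x ^+ 2 + s).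
  pose L' j ys := L j.+1 (y :: ys); pose phi' ys := phi (y :: ys).
  have fE (u : pt R d.+1) :
      b + @comb R X d.+2 (x, u) w' = b' + comb u (fun i => w' i.+1).
    by rewrite comb_cons addrA.
  (* The first functional vanishes on the remaining directions, so the whole slice shares the answer
     [y]. *)
  have yE (u : pt R d.+1) : L 0%N [::] (b' + comb u (fun i => w' i.+1)) = y.
    have := lin0 1 b' (comb u (fun i => w' i.+1)); rewrite !scale1r => ->.
    rewrite (comb_linear u _ lin0) (@eq_comb R _ _ u _ (fun=> 0)) => [|i id].
      by rewrite -(@comb_linear R _ _ (fun x : R^o => 0 : R^o) _ u (fun=> 0))
        ?addr0// => c v v'; rewrite scaler0 addr0.
    exact: lQ.
  have g'E (u : pt R d.+1) :
      g' (x, u) = weighted_error k b' (fun i => w' i.+1) L' phi' rhox u.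
    by rewrite /g' /weighted_error fE alg_out_cons yE.
  rewrite (eq_integral _ _ (fun u _ => congr1 EFin (g'E u))).
  apply: (IH d.+1 b' (fun i => w' i.+1) L' phi' rhox kd) => //.
  - by apply: measurableT_comp mrho _; exact: measurable_funD.
  - by move=> s; exact: rho0.
  - move=> s rs; apply: supp; apply: lt_le_trans rs _.
    by rewrite lerDr sqr_ge0.
  - move=> u; have := lowS (Q (0, u)).
    by rewrite nQ cQ normsq_cons comb_cons /= expr0n add0r scale0r add0r.
  - by move=> j ys jk; exact: vL.
  - rewrite (_ : weighted_error _ _ _ _ _ _ = fun u : pt R d.+1 => g' (x, u)).
      apply/measurable_EFinP; exact: measurableT_comp mEg' (pair1_measurable x).
    by apply/funext => u; rewrite g'E.
move: slice; rewrite radial_tail_moment// muleCA lee_pmul2l// => slice.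
by rewrite muleCA; apply: lee_wpmul2l.
Qed.

End lower_average.

End adaptive.

(** * Spherical shells and averages over them *)

Section shells.
Context (R : realType).
Local Notation leb := (@lebesgue_measure R).

(** The bounds are squared radii. *)
Definition shell d (a b : R) : set (pt R d) := @normsq R d @^-1` `[a, b]%classic.

Lemma measurable_shell d (a b : R) : measurable (@shell d a b).
Proof. by rewrite -[shell _ _]setTI; exact: measurable_normsq. Qed.

Lemma vol_prod d (A : set (measurableTypeR R)) (B : set (pt R d)) :
  measurable A -> measurable B -> (vol R d.+1 (A `*` B) = leb A * vol R d B)%E.
Proof. exact: product_measure1E. Qed.

Lemma shell_lty d (b : R) : (vol R d (@shell d 0 b) < +oo)%E.
Proof.
elim: d => [|d IH].
  apply: (@le_lt_trans _ _ (vol R 0 setT)).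
    by apply: le_measure; rewrite ?inE//; exact: measurable_shell.
  by rewrite /= diracT ltry.
(* The half-width [b + 1] dominates the square root of [b], also for small [b]. *)
apply: (@le_lt_trans _ _ (vol R d.+1 (`[- (b + 1), b + 1]%classic `*` @shell d 0 b))).
  apply: le_measure; rewrite ?inE.
  - exact: measurable_shell.
  - by apply: measurableX => //; exact: measurable_shell.
  move=> [x u]; rewrite /shell /= !in_itv/= => /andP[_ xub].
  have u0 := normsq_ge0 u; have x0 := sqr_ge0 x.
  rewrite u0 /= (le_trans _ xub) ?lerDr//; split=> //.
  have : x ^+ 2 <= b by apply: le_trans xub; rewrite lerDl.
  by move=> xb; apply/andP; split; nra.
rewrite vol_prod//; last exact: measurable_shell.
by rewrite lte_mul_pinfty// lebesgue_measure_itv/=; case: ifP; rewrite ?ltry.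
Qed.

Lemma ball_gt0 d (b : R) : 0 < b -> (0 < vol R d (@shell d 0 b))%E.
Proof.
elim: d b => [|d IH] b b0.
  rewrite (_ : shell _ _ = setT) /= ?diracT//.
  by apply/seteqP; split => //= u _; rewrite /shell/= in_itv/= lexx ltW.
have c0 : 0 < b / 2 by rewrite divr_gt0.
apply: (@lt_le_trans _ _ (vol R d.+1
    (`[0, Num.sqrt (b / 2)]%classic `*` @shell d 0 (b / 2)))).
  rewrite vol_prod//; last exact: measurable_shell.
  rewrite mule_gt0 ?IH//.
  by rewrite lebesgue_measure_itv/= lte_fin sqrtr_gt0 c0 sube0 lte_fin sqrtr_gt0.
apply: le_measure; rewrite ?inE.
- by apply: measurableX => //; exact: measurable_shell.
- exact: measurable_shell.
move=> [x u]; rewrite /shell /= !in_itv/= => -[/andP[x0 xb] /andP[u0 ub]].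
have {}xb : x ^+ 2 <= b / 2.
  by rewrite -[leRHS]sqr_sqrtr ?(ltW c0)// ler_pXn2r// nnegrE sqrtr_ge0.
by rewrite addr_ge0 ?sqr_ge0//= [b]splitr lerD.
Qed.

(** The shell contains a product of an interval and a ball, with the squared radius split at the
    midpoint [m]. The dimension is positive because in dimension 0 the squared norm is always 0. *)
Lemma shell_gt0 d (a b : R) : 0 <= a -> a < b -> (0 < vol R d.+1 (@shell d.+1 a b))%E.
Proof.
move=> a0 ab; pose m := (a + b) / 2.
have am : a < m by rewrite /m; lra.
have mb : m < b by rewrite /m; lra.
have m0 : 0 <= m by exact: le_trans (ltW am).
apply: (@lt_le_trans _ _ (vol R d.+1
    (`[Num.sqrt a, Num.sqrt m]%classic `*` @shell d 0 (b - m)))).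
  rewrite vol_prod//; last exact: measurable_shell.
  rewrite mule_gt0 ?ball_gt0 ?subr_gt0//.
  have sam : Num.sqrt a < Num.sqrt m by rewrite ltr_sqrt// (le_lt_trans a0).
  by rewrite lebesgue_measure_itv/= lte_fin sam -EFinB lte_fin subr_gt0.
apply: le_measure; rewrite ?inE.
- by apply: measurableX => //; exact: measurable_shell.
- exact: measurable_shell.
move=> [x u]; rewrite /shell /= !in_itv/= => -[/andP[ax xm] /andP[u0 ub]].
have x0 : 0 <= x by exact: le_trans (sqrtr_ge0 _) ax.
have {}xm : x ^+ 2 <= m.
  by rewrite -[leRHS]sqr_sqrtr// ler_pXn2r// nnegrE sqrtr_ge0.
have {}ax : a <= x ^+ 2.
  by rewrite -[leLHS]sqr_sqrtr// ler_pXn2r// nnegrE sqrtr_ge0.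
by rewrite (le_trans ax) ?lerDl//= -(subrKC m b) lerD.
Qed.

End shells.

Section randomized_average.
Context (R : realType) (X Y : normedModType R) (S : X -> Y) (sigma r : R).
Hypotheses (linS : is_linear_map S) (sigma_ge0 : 0 <= sigma) (r_gt0 : 0 < r).

(* The shell with inner squared radius r^2 (2k+1)/(2k+2) balances the loss
   (k+1)/(2k+1) of the averaging argument to exactly 1/2. *)
Definition inner_sq k : R := r ^+ 2 * ((2 * k + 1)%:R / (2 * k + 2)%:R).

Lemma inner_sq_lt k : 0 <= inner_sq k < r ^+ 2.
Proof.
rewrite /inner_sq mulr_ge0 ?sqr_ge0 ?divr_ge0//=.
by rewrite -[ltRHS]mulr1 ltr_pM2l ?exprn_gt0// ltr_pdivrMr ?mul1r ?ltr_nat ?ltr0n ?addn2// addn1.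
Qed.

(** The weight in [adaptive_average] is taken to be the indicator of the shell, on which the squared
    norm is at least [inner_sq r k]. *)
Lemma shell_average k (b : X) (w : nat -> X) (L : nat -> seq R -> X -> R)
    (phi : seq R -> Y) (E := @shell R (2 * k + 1) (inner_sq k) (r ^+ 2)) :
  (forall z : pt R (2 * k + 1), sigma * Num.sqrt (normsq z) <= `|S (comb z w)|) ->
  valid_info k L ->
  measurable_fun E (fun z => `|S (b + comb z w) - alg_out k L phi (b + comb z w)|) ->
  ((sigma * r / 2)%:E * vol R _ E <=
   \int[vol R (2 * k + 1)]_(z in E)
     (`|S (b + comb z w) - alg_out k L phi (b + comb z w)|)%:E)%E.
Proof.
move=> lowS vL mg; set d := (2 * k + 1)%N in E lowS mg *.
set g := fun z => _ in mg; rewrite -/(g _).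
pose I : set R := `[inner_sq k, r ^+ 2]%classic.
pose rho : R -> R := \1_I.
have mI : measurable I by exact: measurable_itv.
have mE : measurable E by exact: measurable_shell.
have rhoE (z : pt R d) : rho (normsq z) = \1_E z by rewrite /rho !indicE.
have wE : weighted_error S k b w L phi rho = g \_ E.
  apply/funext => z; rewrite /weighted_error rhoE indicE patchE.
  by case: ifP; rewrite ?mul1r ?mul0r.
have kd : (k < d)%N by rewrite /d addn1 ltnS mul2n -addnn leq_addr.
have := @adaptive_average R X Y S sigma r linS sigma_ge0 r_gt0 k d b w L phi rho kd.
have -> : (\int[vol R d]_z (weighted_error S k b w L phi rho z)%:E =
          \int[vol R d]_(z in E) (g z)%:E)%E.
  rewrite wE [RHS]integral_mkcond; apply: eq_integral => z _.
  by rewrite !patchE; case: ifP.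
move=> /(_ _ _ _ lowS vL) h.
have {}h : ((sigma / r * (d - k)%:R)%:E * \int[vol R d]_z (rho (normsq z) * normsq z)%:E <=
  d%:R%:E * \int[vol R d]_(z in E) (g z)%:E)%E.
  apply: h.
  - exact: measurable_indic.
  - by move=> s; rewrite /rho indicE.
  - move=> s rs; rewrite /rho indicE memNset// /I /= in_itv/= => /andP[_].
    by rewrite leNgt rs.
  - by rewrite wE; apply/(measurable_restrictT _ _).1.
have d0 : (0 < d%:R :> R) by rewrite ltr0n (leq_trans _ kd).
rewrite -(@lee_pmul2l _ d%:R%:E)//; apply: le_trans h.
have -> : ((sigma * r / 2)%:E * vol R d E =
    (sigma * r / 2)%:E * \int[vol R d]_z (\1_E z)%:E)%E by rewrite integral_indic// setIT.
have m1 : measurable_fun [set: pt R d] (fun z => (rho (normsq z) * normsq z)%:E).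
  apply/measurable_EFinP/measurable_funM; last exact: measurable_normsq.
  exact/measurable_radial/measurable_indic.
have m2 : measurable_fun [set: pt R d] (fun z => (\1_E z)%:E : \bar R).
  by apply/measurable_EFinP; exact: measurable_indic.
have c1 : 0 <= d%:R * (sigma * r / 2) by rewrite mulr_ge0// divr_ge0// mulr_ge0// ltW.
have c2 : 0 <= sigma / r * (d - k)%:R by rewrite !mulr_ge0// invr_ge0 ltW.
rewrite muleA -EFinM -!ge0_integralZl//; last first.
- by move=> z _; rewrite lee_fin mulr_ge0 ?normsq_ge0// /rho indicE.
- apply: ge0_le_integral => //.
  + by move=> z _; rewrite mule_ge0.
  + exact: measurable_funeM.
  + exact: measurable_funeM.
  move=> z _; rewrite -!EFinM lee_fin rhoE indicE.
  have [/set_mem|] := boolP (z \in E); last by rewrite !mul0r !mulr0.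
  rewrite /E /shell/= in_itv/= mulr1 mul1r => /andP[lo _].
  apply: (@le_trans _ _ (sigma / r * (d - k)%:R * inner_sq k)); last by rewrite ler_wpM2l.
  rewrite /inner_sq (_ : (d - k = k + 1)%N); last by rewrite /d; lia.
  rewrite /d le_eqVlt; apply/orP; left; apply/eqP.
  have r0 : r != 0 by rewrite gt_eqF.
  have k0 : 2 * k%:R + 2 != 0 :> R by rewrite gt_eqF// ltr_wpDl// mulr_ge0.
  have -> : (2 * k + 1)%:R = 2 * k%:R + 1 :> R by rewrite natrD natrM.
  have -> : (2 * k + 2)%:R = 2 * k%:R + 2 :> R by rewrite natrD natrM.
  rewrite natrD; field.
  by rewrite r0 k0.
Qed.

End randomized_average.

(** * Measurability of the error along a ball in [F] *)

Section metric.
Context (R : realType).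

(** The l1 distance can be measured and approximated one coordinate at a time, and it dominates the
    Euclidean norm. *)
Fixpoint dist1 d : pt R d -> pt R d -> R :=
  match d return pt R d -> pt R d -> R with
  | 0 => fun _ _ => 0
  | d'.+1 => fun z q => `|z.1 - q.1| + dist1 z.2 q.2
  end.

Fixpoint psub d : pt R d -> pt R d -> pt R d :=
  match d return pt R d -> pt R d -> pt R d with
  | 0 => fun z _ => z
  | d'.+1 => fun z q => (z.1 - q.1, psub z.2 q.2)
  end.

Fixpoint pscale d (a : R) : pt R d -> pt R d :=
  match d return pt R d -> pt R d with
  | 0 => id
  | d'.+1 => fun z => (a * z.1, pscale a z.2)
  end.

Fixpoint rational_pt d (s : seq rat) : pt R d :=
  match d return pt R d with
  | 0 => tt
  | d'.+1 => (ratr (head 0 s), rational_pt d' (behead s))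
  end.

Lemma dist1_ge0 d (z q : pt R d) : 0 <= dist1 z q.
Proof. by elim: d z q => //= d IH z q; rewrite addr_ge0. Qed.

Lemma dist1C d (z q : pt R d) : dist1 z q = dist1 q z.
Proof. by elim: d z q => //= d IH z q; rewrite distrC IH. Qed.

Lemma dist1_triangle d (y z q : pt R d) : dist1 z q <= dist1 z y + dist1 y q.
Proof.
elim: d y z q => [|d IH] y z q /=; first by rewrite addr0.
by rewrite addrACA lerD// ler_distD.
Qed.

Lemma measurable_dist1 d (q : pt R d) : measurable_fun [set: pt R d] (fun z => dist1 z q).
Proof.
elim: d q => [|d IH] q /=; first exact: measurable_cst.
apply: measurable_funD.
  apply: measurableT_comp; first exact: normr_measurable.
  by apply: measurable_funB => //; exact: measurable_fst.
exact: measurableT_comp (IH q.2) measurable_snd.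
Qed.

Lemma rational_pt_dense d (z : pt R d) (e : R) : 0 < e ->
  exists s, dist1 z (rational_pt d s) < e.
Proof.
elim: d z e => [|d IH] z e e0; first by exists [::].
have e2 : 0 < e / 2 by rewrite divr_gt0.
have [s zs] := IH z.2 _ e2.
have [q] := @rat_in_itvoo R z.1 (z.1 + e / 2) ltac:(by rewrite ltrDl).
rewrite in_itv/= => /andP[zq qz]; exists (q :: s) => /=.
rewrite [e]splitr ltrD// distrC gtr0_norm ?subr_gt0//.
by rewrite ltrBlDl.
Qed.

Lemma normsq_psub d (z q : pt R d) : normsq (psub z q) <= dist1 z q ^+ 2.
Proof.
elim: d z q => [|d IH] z q /=; first by rewrite expr0n.
set a := z.1 - q.1.
have -> : a ^+ 2 = `|a| ^+ 2 by rewrite -normrX ger0_norm ?sqr_ge0.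
rewrite sqrrD -addrA lerD2l; apply: le_trans (IH z.2 q.2) _.
by rewrite lerDr mulrn_wge0// mulr_ge0// dist1_ge0.
Qed.

Lemma normsq_pscale d a (z : pt R d) : normsq (pscale a z) = a ^+ 2 * normsq z.
Proof.
by elim: d z => [|d IH] z /=; rewrite ?mulr0// IH exprMn mulrDr.
Qed.

Context (V : lmodType R).

Lemma comb_psub d (z q : pt R d) (w : nat -> V) :
  comb (psub z q) w = comb z w - comb q w.
Proof.
elim: d z q w => [|d IH] z q w /=; first by rewrite subr0.
by rewrite IH scalerBl opprD addrACA.
Qed.

Lemma comb_pscale d a (z : pt R d) (w : nat -> V) :
  comb (pscale a z) w = a *: comb z w.
Proof.
by elim: d z w => [|d IH] z w /=; rewrite ?scaler0// IH scalerDr scalerA.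
Qed.

End metric.

Section product_measurability.
Context (R : realType).

(** The sets whose preimage has a measurable trace on [B] satisfy the closure properties of a
    sigma-algebra; complements are relative to [D], which is why [h] has to map [B] into [D]. *)
Lemma measurable_preimage_generated d (T : measurableType d) (U : Type)
    (D : set U) (G : set (set U)) (B : set T) (h : T -> U) :
  measurable B -> (forall z, B z -> D (h z)) ->
  (forall V, G V -> measurable (B `&` h @^-1` V)) ->
  forall V, <<s D, G >> V -> measurable (B `&` h @^-1` V).
Proof.
move=> mB BD mG V; apply: (@smallest_sub _ (sigma_algebra D) G
  [set V | measurable (B `&` h @^-1` V)]); last exact: mG.
split => /=.
- by rewrite preimage_set0 setI0.
- move=> A mA.
  have -> : B `&` h @^-1` (D `\` A) = B `\` (B `&` h @^-1` A).
    apply/seteqP; split=> z /=; first by move=> [Bz [_ nA]]; split=> // -[].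
    by move=> [Bz nBA]; split=> //; split; [exact: BD | move=> Az; exact: nBA].
  exact: measurableD.
- move=> A mA; rewrite preimage_bigcup setI_bigcupr.
  exact: bigcupT_measurable.
Qed.

Section ball.
Context (X : lmodType R) (F : set X) (d : nat) (b : X) (w : nat -> X) (r : R).
Hypotheses (r_gt0 : 0 < r)
  (ballF : forall z : pt R d, normsq z <= r ^+ 2 -> F (b + comb z w)).
Local Notation f := (fun z : pt R d => b + comb z w).
Local Notation B := (@shell R d 0 (r ^+ 2)).

(** Scaling [z' - z] by [2 / e] gives a vector [u] of norm at most [r], so [b + comb u w] and [b]
    both lie in [F]. The spare factor 2 makes the inequality strict. *)
Lemma minkowski_comb (z z' : pt R d) (e : R) : dist1 z z' < e * r / 2 ->
  (Defs.minkowski (diff_set F) (f z' - f z) < e%:E)%E.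
Proof.
move=> zz'.
have e0 : 0 < e.
  have : 0 < e * r / 2 by exact: le_lt_trans (dist1_ge0 _ _) zz'.
  by rewrite pmulr_lgt0 ?invr_gt0// pmulr_lgt0.
apply: (@le_lt_trans _ _ (e / 2)%:E); last by rewrite lte_fin ltr_pdivrMr// ltr_pMr// ltr1n.
apply: ereal_inf_lbound; exists (e / 2) => //; split; first by rewrite divr_gt0.
pose v := psub z' z; pose u := pscale (e / 2)^-1 v.
have e2 : e / 2 != 0 by rewrite gt_eqF// divr_gt0.
exists (comb u w); split; last first.
  by rewrite /u comb_pscale scalerA divff// scale1r /v comb_psub opprD addrACA subrr add0r.
exists (b + comb u w).
  apply: ballF; rewrite /u normsq_pscale exprVn ler_pdivrMl; last first.
    by rewrite exprn_gt0// divr_gt0.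
  apply: le_trans (normsq_psub _ _) _; rewrite -exprMn ler_pXn2r ?nnegrE ?dist1_ge0//.
    by rewrite dist1C mulrAC ltW.
  by rewrite mulr_ge0// ltW// divr_gt0.
exists b; last by rewrite addrAC subrr add0r.
have := ballF (z := pscale 0 z); rewrite normsq_pscale expr0n mul0r comb_pscale.
by rewrite scale0r addr0; apply; exact: sqr_ge0.
Qed.

(** By [minkowski_comb] the preimage is relatively open in the ball, hence the trace of a countable
    union of balls with rational centre and radius. *)
Lemma measurable_preimage_F_open (U : set X) :
  F_open F U -> measurable (B `&` f @^-1` U).
Proof.
move=> [UF Uopen].
pose good (p : seq rat * rat) := forall z' : pt R d,
  B z' -> dist1 z' (rational_pt R d p.1) < ratr p.2 -> U (f z').
have -> : B `&` f @^-1` U = B `&` \bigcup_p [set z : pt R d | good p /\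
    dist1 z (rational_pt R d p.1) < ratr p.2].
  apply/seteqP; split=> z [Bz].
    move=> Uz; split=> //.
    have [e e0 Ue] := Uopen _ Uz.
    (* The second halving pays for recentring: two points closer than [q] to the rational centre are
       closer than [e * r / 2] to each other. *)
    have d0 : 0 < e * r / 2 / 2 by rewrite !divr_gt0// mulr_gt0.
    have [q] := rat_in_itvoo d0; rewrite in_itv/= => /andP[q0 qd].
    have [s zs] := rational_pt_dense z q0.
    exists (s, q) => //=; split=> // z' Bz' z's; apply: Ue.
      by apply: ballF; move: Bz'; rewrite /shell/= in_itv/= => /andP[].
    apply: minkowski_comb; apply: le_lt_trans (dist1_triangle (rational_pt R d s) _ _) _.
    by rewrite [X in _ < X]splitr ltrD// ?(lt_trans zs)// dist1C (lt_trans z's).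
  by move=> [p _ [gp zp]]; split=> //; exact: gp.
apply: measurableI; first exact: measurable_shell.
apply: countable_bigcupT_measurable; first exact: countableP.
move=> p; have [gp|ngp] := pselect (good p); last first.
  by rewrite (_ : [set _ | _] = set0)//; apply/seteqP; split=> // z [].
rewrite (_ : [set _ | _] = setT `&` (fun z => dist1 z (rational_pt R d p.1)) @^-1` `]-oo, ratr p.2[%classic).
  by apply: measurable_dist1.
by apply/seteqP; split=> z /=; rewrite in_itv/=; [case|move=> []].
Qed.

Lemma measurable_preimage_borel_F (V : set X) :
  borel_F F V -> measurable (B `&` f @^-1` V).
Proof.
apply: measurable_preimage_generated.
- exact: measurable_shell.
- by move=> z; rewrite /shell/= in_itv/= => /andP[_]; exact: ballF.
- exact: measurable_preimage_F_open.
Qed.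

Lemma measurable_preimage_prod_sigma (d' : measure_display) (Om : measurableType d')
    (M : set (X * Om)) : prod_sigma F M ->
  measurable ((B `*` [set: Om]) `&` (fun p => (f p.1, p.2)) @^-1` M).
Proof.
apply: measurable_preimage_generated.
- by apply: measurableX => //; exact: measurable_shell.
- by move=> p [+ _]; rewrite /shell/= in_itv/= => /andP[_] /ballF; split.
move=> _ [V BV [A mA <-]].
rewrite (_ : _ `&` _ = (B `&` f @^-1` V) `*` A).
  by apply: measurableX => //; exact: measurable_preimage_borel_F.
apply/seteqP; split=> -[z o] /=; first by move=> [[Bz _] [Vz Ao]].
by move=> [[Bz Vz] Ao].
Qed.

End ball.

End product_measurability.

(** * Lower bound for randomized algorithms *)

Section randomized_lower_bound.
Context (R : realType) (X Y : normedModType R) (S : X -> Y) (F : set X) (sigma r : R).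
Hypotheses (linS : is_linear_map S) (sigma_ge0 : 0 <= sigma) (r_gt0 : 0 < r).

(** The supremum over [F] dominates the mean over a shell mapped into [F]; Tonelli's theorem swaps
    this mean with the expectation, and [shell_average] applies to each fixed random parameter. *)
Theorem e_ran_lower k (b : X) (w : nat -> X) :
  (forall z : pt R (2 * k + 1), normsq z <= r ^+ 2 -> F (b + comb z w)) ->
  (forall z : pt R (2 * k + 1), sigma * Num.sqrt (normsq z) <= `|S (comb z w)|) ->
  ((sigma * r / 2)%:E <= e_ran k S F)%E.
Proof.
move=> ballF lowS; apply: le_ereal_inf_tmp => x [d [Om [P [L [phi [vL mA ->]]]]]].
set D := (2 * k + 1)%N in ballF lowS *.
pose E := @shell R D (inner_sq r k) (r ^+ 2).
pose f (z : pt R D) := b + comb z w.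
pose g (p : pt R D * Om) := `|S (f p.1) - alg_out k (L p.2) (phi p.2) (f p.1)|.
have /andP[in0 inr] := inner_sq_lt r_gt0 k.
have mE : measurable E by exact: measurable_shell.
have EB : E `<=` @shell R D 0 (r ^+ 2).
  move=> z; rewrite /E /shell/= !in_itv/= => /andP[lo ->].
  by rewrite andbT (le_trans in0).
have Er z : E z -> normsq z <= r ^+ 2.
  by move=> /EB; rewrite /shell/= in_itv/= => /andP[].
have mET : measurable (E `*` [set: Om]) by exact: measurableX.
have mgB : measurable_fun (@shell R D 0 (r ^+ 2) `*` [set: Om]) g.
  move=> _ C mC.
  have := measurable_preimage_prod_sigma r_gt0 ballF (mA C mC).
  congr (measurable _); apply/seteqP; split=> -[z o] /= [[Bz _] H]; split=> //.
    by case: H.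
  by split=> //; split=> //; apply: ballF; move: Bz; rewrite /shell/= in_itv/= => /andP[].
have mg : measurable_fun (E `*` [set: Om]) g.
  apply: measurable_funS mgB; first by apply: measurableX => //; exact: measurable_shell.
  by move=> [z o] [/EB].
(* The error is extended by 0 outside the shell, since its measurability is known only over the
   ball. *)
pose h (p : pt R D * Om) : \bar R := ((g \_ (E `*` [set: Om])) p)%:E.
have mh : measurable_fun setT h by apply/measurable_EFinP/(measurable_restrictT _ _).1.
have h0 p : (0 <= h p)%E by rewrite lee_fin patchE; case: ifP => _; [exact: normr_ge0 | exact: lexx].
have hE z o : E z -> h (z, o) = (g (z, o))%:E.
  by move=> Ez; rewrite /h patchE mem_set.
have hN z o : ~ E z -> h (z, o) = 0%E.
  by move=> Ez; rewrite /h patchE memNset// => -[].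
have ft := fubini_tonelli (m1 := vol R D) (m2 := P) h mh h0.
set e := supF _ _.
have e0 : (0 <= e)%E by rewrite /e /supF; apply: ereal_sup_ubound; right.
have V0 : (0 < vol R D E)%E by rewrite /E /D addn1; exact: shell_gt0.
have Voo : (vol R D E < +oo)%E.
  apply: le_lt_trans (shell_lty D (r ^+ 2)); apply: le_measure; rewrite ?inE//.
  exact: measurable_shell.
have mhF : measurable_fun [set: pt R D] (fun z => \int[P]_o h (z, o))%E.
  by apply: (measurable_fun_fubini_tonelli_F h).
have mhG : measurable_fun [set: Om] (fun o => \int[vol R D]_z h (z, o))%E.
  by apply: (measurable_fun_fubini_tonelli_G h).
have up : (\int[vol R D]_z \int[P]_o h (z, o) <= e * vol R D E)%E.
  rewrite -(integral_cst (vol R D) mE) [leRHS]integral_mkcond.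
  apply: ge0_le_integral => //.
  - by move=> z _; apply: integral_ge0 => o _.
  - by apply/(measurable_restrictT _ _).1 => //; exact: measurable_cst.
  move=> z _; rewrite patchE; case: ifPn => [/set_mem Ez|/negP Ez].
    rewrite (eq_integral (fun o => (g (z, o))%:E)); last by move=> o _; exact: hE.
    by apply: ereal_sup_ubound; left; exists (f z) => //; apply/ballF/Er.
  by rewrite integral0_eq// => o _; apply: hN => ?; apply: Ez; exact: mem_set.
have lo : ((sigma * r / 2)%:E * vol R D E <= \int[P]_o \int[vol R D]_z h (z, o))%E.
  rewrite -[leLHS]mule1 -(probability_setT P) -(integral_cst P measurableT).
  apply: ge0_le_integral => //.
  - by move=> o _; rewrite mule_ge0 ?lee_fin// divr_ge0// mulr_ge0// ltW.
  move=> o _ /=.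
  have := @shell_average R X Y S sigma r linS sigma_ge0 r_gt0 k b w (L o) (phi o) lowS (vL o).
  rewrite -/D -/E => H.
  apply: le_trans (H _) _.
    apply: (measurable_comp (F := E `*` [set: Om]) (f := g)
      (g := fun z : pt R D => (z, o))) => //.
    - by move=> _ [z Ez <-].
    - by apply: measurable_funTS; exact: pair2_measurable.
  rewrite integral_mkcond le_eqVlt; apply/orP; left; apply/eqP.
  apply: eq_integral => z _.
  rewrite patchE; case: ifPn => [/set_mem Ez|/negP Ez]; first by rewrite hE.
  by rewrite hN// => ?; apply: Ez; exact: mem_set.
rewrite -ft in lo; have := le_trans lo up.
by rewrite lee_pmul2r// ge0_fin_numE// ltW.
Qed.

End randomized_lower_bound.

(** * Norming functionals by Hahn-Banach *)

Section hahn_banach.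
Context (R : realType) (Y : normedModType R).

(** Partial functionals are encoded by their graphs, ordered by inclusion for Zorn's lemma.
    Linearity and domination together force single-valuedness. *)
Definition dominated_graph (G : set (Y * R)) :=
  (forall c p q, G p -> G q -> G (c *: p.1 + q.1, c * p.2 + q.2)) /\
  (forall p, G p -> p.2 <= `|p.1|).

Lemma dominated_graph_fun G x a a' :
  dominated_graph G -> G (x, a) -> G (x, a') -> a = a'.
Proof.
move=> [lG dG].
have h u v : G (x, u) -> G (x, v) -> u <= v.
  move=> Gu Gv; have := dG _ (lG (-1) _ _ Gv Gu).
  by rewrite /= scaleN1r addNr normr0 mulN1r addrC subr_le0.
by move=> Ga Ga'; apply/eqP; rewrite eq_le !h.
Qed.

(** A value [c] at [y] is admissible if it lies between all [p.2 - |p.1 - y|] and all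
    [|q.1 + y| - q.2]; by the triangle inequality the supremum of the former does. *)
Lemma dominated_graph_extend G y : dominated_graph G -> G (0, 0) ->
  exists c, dominated_graph
    [set p | exists q t, G q /\ p = (q.1 + t *: y, q.2 + t * c)].
Proof.
move=> [lG dG] G0.
pose E := [set p.2 - `|p.1 - y| | p in G].
have bound p q : G p -> G q -> p.2 - `|p.1 - y| <= `|q.1 + y| - q.2.
  move=> Gp Gq; have := dG _ (lG 1 _ _ Gp Gq); rewrite /= scale1r mul1r => h.
  rewrite lerBlDr addrAC lerBrDr; apply: le_trans h _.
  have -> : p.1 + q.1 = (q.1 + y) + (p.1 - y) by rewrite addrACA subrr addr0 addrC.
  exact: ler_normD.
have E0 : E !=set0 by exists (0 - `|0 - y|); exists (0, 0).
have ubE q : G q -> ubound E (`|q.1 + y| - q.2) by move=> Gq _ [p Gp <-]; exact: bound.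
have supE : has_sup E by split=> //; exists (`|0 + y| - 0); exact: (ubE (0, 0)).
pose c := sup E.
have c1 p : G p -> p.2 - `|p.1 - y| <= c.
  by move=> Gp; apply: (sup_upper_bound supE); exists p.
have c2 q : G q -> c <= `|q.1 + y| - q.2 by move=> Gq; apply: ge_sup => //; exact: ubE.
have GZ a p : G p -> G (a *: p.1, a * p.2).
  by move=> Gp; have := lG a _ _ Gp G0; rewrite /= !addr0.
exists c; split.
  move=> a _ _ [p [s [Gp ->]]] [q [t [Gq ->]]].
  exists (a *: p.1 + q.1, a * p.2 + q.2), (a * s + t); split; first exact: lG.
  rewrite /= !scalerDr scalerDl scalerA !mulrDr mulrDl mulrA.
  by congr (_, _); rewrite addrACA.
(* Dividing by the absolute value of [t] reduces the bound to [t] equal to 1, -1 or 0. *)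
move=> _ [p [t [Gp ->]]] /=; have [t0|t0|<-] := ltgtP 0 t.
- have := c2 _ (GZ t^-1 _ Gp); rewrite /= -(ler_pM2l t0) mulrBr mulrA divff ?gt_eqF//.
  rewrite mul1r lerBrDl => /le_trans; apply.
  by rewrite -[X in X * _]gtr0_norm// -normrZ scalerDr scalerA divff ?gt_eqF// scale1r.
- have [s s0 ->] : exists2 s, 0 < s & t = - s.
    by exists (- t); rewrite ?oppr_gt0 ?opprK.
  have := c1 _ (GZ s^-1 _ Gp); rewrite /= -(ler_pM2l s0) mulrBr mulrA divff ?gt_eqF//.
  rewrite mul1r lerBlDr mulNr scaleNr lerBlDl => /le_trans; apply; rewrite lerD2l.
  by rewrite -[X in X * _]gtr0_norm// -normrZ scalerBr scalerA divff ?gt_eqF// scale1r.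
- by rewrite scale0r mul0r !addr0; exact: dG.
Qed.

Theorem norming_functional (y0 : Y) : exists l : Y -> R,
  [/\ is_linear_map (l : Y -> R^o), (forall y, `|l y| <= `|y|) & l y0 = `|y0|].
Proof.
pose P G := dominated_graph G /\ (G = set0 \/ G (y0, `|y0|)).
pose line := [set p : Y * R | exists t, p = (t *: y0, t * `|y0|)].
have Pline : P line.
  split; last by right; exists 1; rewrite scale1r mul1r.
  split=> [a _ _ [s ->] [t ->]|_ [t ->]] /=.
    by exists (a * s + t); rewrite scalerDl scalerA mulrDl mulrA.
  by rewrite normrZ ler_wpM2r// ler_norm.
have [A [[dA A0] maxA]] : exists A, P A /\ forall B, A `<` B -> ~ P B.
  apply: Zorn_bigcup => C CP totC.
  have lub p q : (\bigcup_(X in C) X) p -> (\bigcup_(X in C) X) q ->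
      exists2 X, C X & X p /\ X q.
    move=> [X CX Xp] [X' CX' Xq]; have [XX'|X'X] := totC _ _ CX CX'.
      by exists X' => //; split=> //; exact: XX'.
    by exists X => //; split=> //; exact: X'X.
  split; first split.
  - move=> a p q Cp Cq; have [X CX [Xp Xq]] := lub _ _ Cp Cq.
    by exists X => //; apply: (CP _ CX).1.1.
  - by move=> p [X CX Xp]; apply: (CP _ CX).1.2.
  have [->|/set0P[p [X CX Xp]]] := eqVneq (\bigcup_(X in C) X) set0; first by left.
  right; exists X => //; have [_ [X0|//]] := CP _ CX.
  by move: Xp; rewrite X0.
have {A0} Ay0 : A (y0, `|y0|).
  case: A0 => // A0; exfalso; apply: (maxA line) => //.
  rewrite A0; split; first by move=> p [].
  by move=> /(_ (y0, `|y0|)); apply; exists 1; rewrite scale1r mul1r.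
have A00 : A (0, 0).
  by have := dA.1 (-1) _ _ Ay0 Ay0; rewrite /= scaleN1r mulN1r !addNr.
have domA y : exists a, A (y, a).
  apply: contrapT => nA; have [c dB] := dominated_graph_extend y dA A00.
  set B := [set p | _] in dB.
  apply: (maxA B).
    split; first by move=> p Ap; exists p, 0; rewrite scale0r mul0r !addr0 -surjective_pairing.
    move=> /(_ (y, c)) BA; apply: nA; exists c; apply: BA.
    by exists (0, 0), 1; rewrite /= scale1r mul1r !add0r.
  split=> //; right; exists (y0, `|y0|), 0.
  by rewrite /= scale0r mul0r !addr0.
have [l lA] := choice domA.
exists l; split.
- move=> a x y; apply: (dominated_graph_fun dA (lA _)).
  exact: (dA.1 a _ _ (lA x) (lA y)).
- move=> y; rewrite ler_norml; have /= -> := dA.2 _ (lA y); rewrite andbT lerNl.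
  have := dA.2 _ (dA.1 (-1) _ _ (lA y) A00).
  by rewrite /= mulN1r scaleN1r !addr0 normrN.
- exact: (dominated_graph_fun dA (lA _)).
Qed.

End hahn_banach.

(** * Spectral theorem for real symmetric matrices *)

Section spectral_theorem.
Context (R : rcfType).

(** Over the complex numbers the matrix is hermitian, so its eigenvalues are real, and a real root
    of the characteristic polynomial is an eigenvalue over [R]. *)
Lemma symmetric_eigenvalue m (A : 'M[R]_m.+1) : A^T = A -> exists a, eigenvalue A a.
Proof.
move=> symA; pose f := real_complex R; pose AC := map_mx f A.
have hA : AC \is hermsymmx.
  apply: realsym_hermsym.
    by apply/is_hermitianmxP; rewrite expr0 scale1r map_mx_id// map_trmx symA.
  by apply/mxOverP => i j; rewrite mxE; apply/complex_realP; exists (A i j).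
have /orthomx_spectralP AE : AC \is normalmx by exact: hermitian_normalmx.
have /mxOverP/(_ 0 0)/complex_realP[a aE] := hermitian_spectral_diag_real hA.
set U := spectralmx AC in AE; set D := spectral_diag AC in AE aE.
have Uu : U \in unitmx by exact: spectral_unit.
have ev : eigenvalue AC (D 0 0).
  apply/eigenvalueP; exists (row 0 U).
    rewrite -row_mul {1}AE !mulmxA mulmxV// mul1mx row_mul row_diag_mx.
    by rewrite -scalemxAl -rowE.
  apply/negP => /eqP U0; have : row 0 (U *m invmx U) = 0 by rewrite row_mul U0 mul0mx.
  rewrite mulmxV// => /rowP/(_ 0); rewrite !mxE eqxx => /eqP.
  by rewrite oner_eq0.
exists a; rewrite eigenvalue_root_char.
rewrite -(fmorph_root f) map_char_poly -/AC -eigenvalue_root_char.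
by rewrite aE in ev.
Qed.

Definition dot m (u v : 'rV[R]_m) : R := (u *m v^T) 0 0.

Lemma dotE m (u v : 'rV[R]_m) : u *m v^T = (dot u v)%:M.
Proof. exact: mx11_scalar. Qed.

Lemma dot_sum m (u v : 'rV[R]_m) : dot u v = \sum_i u 0 i * v 0 i.
Proof. by rewrite /dot mxE; apply: eq_bigr => i _; rewrite mxE. Qed.

Lemma dot_ge0 m (u : 'rV[R]_m) : 0 <= dot u u.
Proof. by rewrite dot_sum sumr_ge0// => i _; rewrite -expr2 sqr_ge0. Qed.

Lemma dot_gt0 m (u : 'rV[R]_m) : u != 0 -> 0 < dot u u.
Proof.
move=> u0; rewrite lt_neqAle dot_ge0 andbT eq_sym; apply: contra u0 => /eqP d0.
apply/eqP/rowP => i; rewrite mxE; move: d0; rewrite dot_sum => /eqP.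
rewrite psumr_eq0 => [/allP/(_ i)|j _]; last by rewrite -expr2 sqr_ge0.
by rewrite mem_index_enum => /(_ isT); rewrite mulf_eq0 orbb => /eqP.
Qed.

(* The Householder reflection exchanging the first basis vector and v. *)
Lemma orthogonal_completion m (v : 'rV[R]_(1 + m)) : dot v v = 1 ->
  exists H : 'M[R]_(1 + m), [/\ H *m H^T = 1%:M & row 0 H = v].
Proof.
move=> vv; pose e : 'rV[R]_(1 + m) := delta_mx 0 0.
have ee : dot e e = 1.
  by rewrite /dot /e trmx_delta mul_delta_mx mxE !eqxx.
have [->|ve] := eqVneq v e.
  by exists 1%:M; rewrite trmx1 mul1mx row1.
have [u uE] : exists u, u = v - e by exists (v - e).
have uu0 : 0 < dot u u by rewrite dot_gt0// uE subr_eq0.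
have dC (x y : 'rV[R]_(1 + m)) : dot x y = dot y x.
  by rewrite !dot_sum; apply: eq_bigr => i _; rewrite mulrC.
have uuE2 : dot u u = 2 - 2 * dot e v.
  rewrite uE {1}/dot linearB/= mulmxBl !mulmxBr !dotE vv ee (dC v e).
  by rewrite !mxE eqxx !mulr1n; ring.
have eu : dot e u = - (dot u u / 2).
  rewrite uuE2 uE {1}/dot linearB/= mulmxBr !dotE ee !mxE eqxx !mulr1n.
  by field.
exists (1%:M - (2 / dot u u) *: (u^T *m u)); split.
  have tT : (1%:M - (2 / dot u u) *: (u^T *m u))^T = 1%:M - (2 / dot u u) *: (u^T *m u).
    by rewrite linearB/= trmx1 linearZ/= trmx_mul trmxK.
  rewrite tT mulmxBl mul1mx mulmxBr mulmx1 -scalemxAl -scalemxAr.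
  have -> : u^T *m u *m (u^T *m u) = dot u u *: (u^T *m u).
    by rewrite mulmxA -(mulmxA u^T u u^T) dotE mul_mx_scalar -scalemxAl.
  rewrite !scalerA -[_ * dot u u]mulrA divfK ?gt_eqF//.
  rewrite -scalerBl -addrA -opprD -scalerDl.
  have -> (c : R) : c + (c - c * 2) = 0 by ring.
  by rewrite scale0r subr0.
rewrite rowE -/e mulmxBr mulmx1 -scalemxAr mulmxA dotE mul_scalar_mx scalerA eu.
rewrite (_ : 2 / dot u u * - (dot u u / 2) = -1).
  by rewrite scaleN1r opprK uE addrC subrK.
by field; rewrite gt_eqF.
Qed.

(** Deflation: a unit eigenvector is completed to an orthogonal matrix [H], and by symmetry
    conjugation with [H] gives a block-diagonal matrix with a smaller symmetric block. *)
Theorem spectral_real m (A : 'M[R]_m) : A^T = A ->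
  exists (P : 'M[R]_m) (D : 'rV[R]_m), P *m P^T = 1%:M /\ A = P^T *m diag_mx D *m P.
Proof.
elim: m A => [|m IH] A symA.
  by exists 1%:M, 0; split; apply/matrixP => -[].
have [a /eigenvalueP[v0 v0A v00]] := symmetric_eigenvalue symA.
pose v := (Num.sqrt (dot v0 v0))^-1 *: v0.
have n0 := dot_gt0 v00.
have vA : v *m A = a *: v by rewrite /v -scalemxAl v0A !scalerA mulrC.
have vv : dot v v = 1.
  rewrite /dot /v linearZ/= -scalemxAl -scalemxAr dotE !mxE eqxx mulr1n mulrA.
  by rewrite -invfM -expr2 sqr_sqrtr ?ltW// mulVf// gt_eqF.
have [H [HH Hv]] := @orthogonal_completion m v vv.
have HtH : H^T *m H = 1%:M by exact: mulmx1C.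
pose B : 'M[R]_(1 + m) := H *m A *m H^T.
have symB : B^T = B by rewrite /B !trmx_mul trmxK symA mulmxA.
have rB : row 0 B = a *: delta_mx 0 0.
  rewrite /B -mulmxA row_mul Hv mulmxA vA -scalemxAl -Hv -row_mul HH row1.
  by [].
have Bur : ursubmx B = 0.
  apply/matrixP => i j; rewrite !mxE; have /rowP/(_ (rshift 1 j)) := rB.
  rewrite !mxE (_ : lshift m i = 0); last by apply/val_inj; rewrite /= ord1.
  by move=> ->; rewrite mulr0.
have Bul : ulsubmx B = a%:M.
  apply/matrixP => i j; rewrite !ord1 !mxE; have /rowP/(_ 0) := rB.
  rewrite !mxE (_ : lshift m 0 = 0); last by apply/val_inj.
  by move=> ->; rewrite mulr1 mulr1n.
have Bdl : dlsubmx B = 0 by rewrite -symB -trmx_ursub Bur trmx0.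
have symB' : (drsubmx B)^T = drsubmx B by rewrite trmx_drsub symB.
have [P [D [PP BE]]] := IH _ symB'.
pose Q : 'M[R]_(1 + m) := block_mx 1%:M 0 0 P.
have QQ : Q *m Q^T = 1%:M.
  rewrite /Q (tr_block_mx 1%:M 0 0 P) mulmx_block.
  by rewrite !trmx0 trmx1 !(mul0mx, mulmx0, mul1mx, addr0, add0r) PP -scalar_mx_block.
have BQ : B = Q^T *m diag_mx (row_mx a%:M D) *m Q.
  rewrite -(submxK B) Bul Bur Bdl BE diag_mx_row /Q (tr_block_mx 1%:M 0 0 P) !mulmx_block.
  rewrite !trmx0 !trmx1 !(mul0mx, mulmx0, mul1mx, mulmx1, addr0, add0r).
  congr (block_mx _ _ _ _); apply/matrixP => i j; rewrite !ord1 !mxE.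
  by [].
exists (Q *m H), (row_mx a%:M D); split.
  by rewrite trmx_mul mulmxA -(mulmxA Q) HH mulmx1.
have -> : A = H^T *m B *m H.
  by rewrite /B !mulmxA HtH mul1mx -mulmxA HtH mulmx1.
by rewrite BQ trmx_mul !mulmxA.
Qed.

End spectral_theorem.

(** * Singular values *)

Section singular_values.
Context (R : rcfType).

Lemma dot_comb m (p : nat -> 'rV[R]_m) d (a b : nat -> R) :
  (forall i j, (i < d)%N -> (j < d)%N -> dot (p i) (p j) = (i == j)%:R) ->
  dot (\sum_(i < d) a i *: p i) (\sum_(i < d) b i *: p i) = \sum_(i < d) a i * b i.
Proof.
move=> orth; rewrite /dot linear_sum mulmx_suml summxE; apply: eq_bigr => i _.
rewrite mulmx_sumr summxE (bigD1 i)//= big1 ?addr0 => [|j ji].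
  rewrite linearZ/= -scalemxAl -scalemxAr dotE orth// !mxE !eqxx.
  by rewrite !mulr1n mulr1.
rewrite linearZ/= -scalemxAl -scalemxAr dotE orth// !mxE eqxx eq_sym.
by rewrite (inj_eq val_inj) (negbTE ji) !mulr1n !mulr0.
Qed.

(** The [p i] are orthonormal eigenvectors of [M^T *m M] and the [D i] its eigenvalues in decreasing
    order, that is, the squared singular values. Vectors are rows, so [v *m M^T] is the image of [v]
    under [M]. *)
Lemma singular_system m (M : 'M[R]_m.+1) :
  exists (p : nat -> 'rV[R]_m.+1) (D : nat -> R),
  [/\ forall i, 0 <= D i,
      forall i j, (i <= j < m.+1)%N -> D j <= D i,
      \prod_(i < m.+1) D i = \det M ^+ 2
    & forall d (c : nat -> R), (d <= m.+1)%N -> let v := \sum_(i < d) c i *: p i in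
      dot v v = \sum_(i < d) c i ^+ 2 /\
      dot (v *m M^T) (v *m M^T) = \sum_(i < d) D i * c i ^+ 2].
Proof.
pose A := M^T *m M.
have [P [D [PP AE]]] : exists (P : 'M[R]_m.+1) (D : 'rV[R]_m.+1),
    P *m P^T = 1%:M /\ A = P^T *m diag_mx D *m P.
  by apply: spectral_real; rewrite trmx_mul trmxK.
pose leD := [rel i j : 'I_m.+1 | D 0 j <= D 0 i].
pose s := sort leD (enum 'I_m.+1).
(* Indices out of range fall back to [ord0], which keeps [D i] nonnegative for every [i]. *)
pose sg i := nth ord0 s i.
have ps : perm_eq s (enum 'I_m.+1) by rewrite perm_sort.
have szs : size s = m.+1 by rewrite (perm_size ps) size_enum_ord.
have us : uniq s by rewrite (perm_uniq ps) enum_uniq.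
have sorts : sorted leD s.
  by apply: sort_sorted => i j /=; exact: le_total.
pose p i := row (sg i) P.
have pA i : p i *m A = D 0 (sg i) *: p i.
  rewrite AE /p -row_mul !mulmxA PP mul1mx row_mul row_diag_mx -scalemxAl.
  by rewrite -rowE.
have dotrow x y : dot (row x P) (row y P) = (x == y)%:R.
  transitivity ((P *m P^T) x y); last by rewrite PP mxE.
  by rewrite /dot !mxE; apply: eq_bigr => k _; rewrite !mxE.
have orth d i j : (d <= m.+1)%N -> (i < d)%N -> (j < d)%N -> dot (p i) (p j) = (i == j)%:R.
  move=> dm id jd; rewrite dotrow nth_uniq// szs; exact: leq_trans dm.
have quad v : dot (v *m M^T) (v *m M^T) = dot (v *m A) v.
  by rewrite /dot trmx_mul trmxK /A !mulmxA.
have D0 i : 0 <= D 0 (sg i).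
  have := dot_ge0 (p i *m M^T); rewrite quad pA.
  by rewrite /dot -scalemxAl dotE dotrow eqxx !mxE !mulr1.
exists p, (fun i => D 0 (sg i)); split => //.
- move=> i j /andP[ij jm]; apply: (sorted_leq_nth _ _ ord0 sorts) => //.
  + by move=> y x z /= xy yz; exact: le_trans yz xy.
  + by move=> x /=.
  + by rewrite inE szs (leq_ltn_trans ij).
  + by rewrite inE szs.
- have -> : \prod_(i < m.+1) D 0 (sg i) = \prod_(i <- s) D 0 i.
    by rewrite (big_nth ord0) szs big_mkord.
  rewrite (perm_big _ ps)/= big_enum/=.
  have <- : \det A = \det M ^+ 2 by rewrite det_mulmx det_tr expr2.
  rewrite AE !det_mulmx det_diag mulrAC -det_mulmx (mulmx1C PP) det1 mul1r.
  by [].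
move=> d c dm v.
have dc a b := @dot_comb _ p d a b (fun i j => @orth d i j dm).
split; first by rewrite /v dc; apply: eq_bigr => i _; rewrite expr2.
rewrite quad /v mulmx_suml.
under eq_bigr do rewrite -scalemxAl pA scalerA.
rewrite (dc (fun i => c i * D 0 (sg i))).
by apply: eq_bigr => i _; rewrite mulrAC mulrC expr2.
Qed.

End singular_values.

(** * Greedy choice of differences *)

Section nonadaptive_gap.
Context (R : realType) (X Y : normedModType R) (S : X -> Y) (F : set X).
Hypothesis bS : bounded_linear S.

Lemma in_dual_comp (l : Y -> R) : in_dual l -> in_dual (fun x => l (S x)).
Proof.
move: bS => [linS [C SC]] [linl [C' lC]]; split.
  by move=> a x y; rewrite linS linl.
exists (`|C'| * C) => x; apply: le_trans (lC _) _.
apply: (@le_trans _ _ (`|C'| * `|S x|)); first by rewrite ler_wpM2r// ler_norm.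
by rewrite -mulrA ler_wpM2l.
Qed.

Lemma info_inj (lam : nat -> Y -> R) k f g :
  info (fun j _ x => lam j (S x)) f k = info (fun j _ x => lam j (S x)) g k ->
  forall i, (i < k)%N -> lam i (S f) = lam i (S g).
Proof.
elim: k => [//|k IH] /= /rcons_inj[/IH h e] i.
by rewrite ltnS leq_eqVlt => /orP[/eqP -> //|/h].
Qed.

(** Otherwise the algorithm that answers [S g] for some [g] in [F] with the observed information
    would have error at most [a]. *)
Lemma detnon_gap k (lam : nat -> Y -> R) (a : R) :
  (forall i, (i < k)%N -> in_dual (lam i)) -> 0 <= a ->
  (a%:E < e_detnon k S F)%E ->
  exists x y, [/\ F x, F y, forall i, (i < k)%N -> lam i (S x) = lam i (S y)
                & a < `|S x - S y|].
Proof.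
move=> dlam a0; apply: contraPP => nex; apply/negP; rewrite -leNgt.
pose L (j : nat) (ys : seq R) (x : X) := lam j (S x).
(* [xget] falls back to 0 on data that no element of [F] produces. *)
pose phi ys := S (xget 0 [set f | F f /\ info L f k = ys]).
apply: (@le_trans _ _ (wc_error S F (alg_out k L phi))).
  apply: ereal_inf_lbound; exists L, phi; split=> // j ys jk.
  by apply: in_dual_comp; exact: dlam.
apply: ge_ereal_sup => _ [[f Ff <-]|->]; last by rewrite lee_fin.
rewrite lee_fin leNgt; apply/negP => gap; apply: nex.
rewrite /alg_out /phi in gap; set g := xget _ _ in gap.
have [Fg gi] : F g /\ info L g k = info L f k.
  by apply: (@xgetPex _ _ [set f' | F f' /\ info L f' k = info L f k]); exists f.
by exists f, g; split=> //; apply: info_inj; exact: esym.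
Qed.

(** The functionals attached to the earlier differences serve as the information in [detnon_gap];
    two points they cannot distinguish give the next difference. *)
Lemma greedy_sequence (N : Y -> Y -> R) (a : nat -> R) m :
  (forall y, in_dual (N y)) ->
  (forall j, (j < m)%N -> 0 <= a j /\ ((a j)%:E < e_detnon j S F)%E) ->
  exists f g : nat -> X, forall j, (j < m)%N ->
    [/\ F (f j), F (g j), a j < `|S (f j - g j)|
      & forall i, (i < j)%N -> N (S (f i - g i)) (S (f j - g j)) = 0].
Proof.
move=> dN; elim: m => [|m IH] ha; first by exists (fun=> 0), (fun=> 0).
have [|f [g fg]] := IH; first by move=> j jm; apply: ha; rewrite ltnS ltnW.
have [a0 am] := ha m (ltnSn m).
have SB x y : S (x - y) = S x - S y.
  have [linS _] := bS; have := linS (-1) y x.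
  by rewrite !scaleN1r addrC [RHS]addrC.
have NB z x y : N z (x - y) = N z x - N z y.
  have [linN _] := dN z; have := linN (-1) y x.
  by rewrite !scaleN1r addrC [RHS]addrC.
have [x [y [Fx Fy xy gap]]] := @detnon_gap m (fun i => N (S (f i - g i))) (a m)
  (fun i _ => dN _) a0 am.
exists (fun j => if j == m then x else f j), (fun j => if j == m then y else g j).
move=> j; rewrite ltnS leq_eqVlt => /orP[/eqP->|jm].
  rewrite eqxx; split=> //; first by rewrite SB.
  by move=> i im; rewrite ltn_eqF// [S (x - y)]SB NB xy// subrr.
rewrite ltn_eqF//; have [Ff Fg aj orth] := fg j jm; split=> // i ij.
by rewrite ltn_eqF ?(ltn_trans ij)// orth.
Qed.

End nonadaptive_gap.

(** * Euclidean balls inside convex sets *)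

Section convexity.
Context (R : realType) (X : lmodType R) (F : set X).
Hypothesis convF : convex_set F.

Lemma convex_comb2 x y (t : R) : 0 <= t <= 1 -> F x -> F y -> F (t *: x + (1 - t) *: y).
Proof.
move=> /andP[t0 t1] Fx Fy.
have := convF (Itv01 t0 t1) (mem_set Fx) (mem_set Fy).
by rewrite inE.
Qed.

(** Keeping the total weight as a factor, instead of normalising it, covers weights that all vanish
    and totals other than 1. *)
Lemma convex_cone m (l : 'I_m -> R) (x : 'I_m -> X) : F !=set0 ->
  (forall j, 0 <= l j) -> (forall j, F (x j)) ->
  exists2 y, F y & \sum_j l j *: x j = (\sum_j l j) *: y.
Proof.
move=> [y0 Fy0]; elim: m l x => [|m IH] l x l0 Fx.
  by exists y0 => //; rewrite !big_ord0 scale0r.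
have [y Fy E] := IH (fun j => l (lift ord0 j)) (fun j => x (lift ord0 j))
  (fun j => l0 _) (fun j => Fx _).
rewrite !big_ord_recl {}E; set s := \sum_(i < m) _.
have s0 : 0 <= s by rewrite sumr_ge0.
have [ls0|ls0] := eqVneq (l ord0 + s) 0.
  exists y => //; move: ls0 => /eqP; rewrite paddr_eq0// => /andP[/eqP-> /eqP->].
  by rewrite addr0 !scale0r addr0.
exists ((l ord0 / (l ord0 + s)) *: x ord0 + (1 - l ord0 / (l ord0 + s)) *: y).
  apply: convex_comb2 => //; rewrite divr_ge0 ?addr_ge0//=.
  by rewrite ler_pdivrMr ?mul1r ?lerDl// lt_neqAle eq_sym ls0 addr_ge0.
rewrite scalerDr !scalerA mulrBr mulr1 mulrC divfK//.
by rewrite addrAC subrr add0r.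
Qed.

Section ball.
Context (m : nat) (f g : 'I_m -> X).
Hypotheses (m_gt0 : (0 < m)%N) (Ff : forall j, F (f j)) (Fg : forall j, F (g j)).

Let F0 : F !=set0.
Proof. by exists (f (Ordinal m_gt0)). Qed.

Let m0 : (0 : R) < m%:R. Proof. by rewrite ltr0n. Qed.

(** The centre is the mean of the midpoints of [f j] and [g j]. As [|m t_j| <= 1/2], the perturbed
    point is the mean of the points [(1/2 + m t_j) f_j + (1/2 - m t_j) g_j] on these segments. *)
Lemma convex_ball : exists x0, forall t : 'I_m -> R,
  \sum_j t j ^+ 2 <= (2 * m%:R)^-1 ^+ 2 -> F (x0 + \sum_j t j *: (f j - g j)).
Proof.
exists (\sum_j m%:R^-1 *: (2^-1 *: (f j + g j))) => t ht.
have tj j : `|m%:R * t j| <= 2^-1.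
  have : t j ^+ 2 <= (2 * m%:R)^-1 ^+ 2.
    apply: le_trans ht; rewrite (bigD1 j)//= lerDl sumr_ge0// => i _; exact: sqr_ge0.
  rewrite -(ler_sqrt (t j ^+ 2)) ?sqr_ge0// !sqrtr_sqr.
  rewrite (ger0_norm (_ : 0 <= (2 * m%:R)^-1)) ?invr_ge0 ?mulr_ge0// => h.
  rewrite normrM gtr0_norm// -(ler_pM2l (_ : 0 < m%:R^-1)) ?invr_gt0//.
  by rewrite mulrA mulVf ?gt_eqF// mul1r -invfM mulrC.
have [||y Fy yE] := @convex_cone m (fun=> m%:R^-1)
  (fun j => (2^-1 + m%:R * t j) *: f j + (1 - (2^-1 + m%:R * t j)) *: g j) F0 _ _.
- by move=> j; rewrite invr_ge0 ltW.
- move=> j; apply: convex_comb2 => //.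
  by have := tj j; rewrite ler_norml => /andP[? ?]; apply/andP; split; lra.
suff -> : \sum_j m%:R^-1 *: (2^-1 *: (f j + g j)) + \sum_j t j *: (f j - g j) = y by [].
transitivity ((\sum_(j < m) m%:R^-1) *: y); last first.
  by rewrite sumr_const card_ord -[_ *+ m]mulr_natl divff ?gt_eqF// scale1r.
rewrite -yE -big_split; apply: eq_bigr => j _ /=.
have mt : m%:R^-1 * (m%:R * t j) = t j by rewrite mulrA mulVf ?gt_eqF// mul1r.
have -> : 1 - (2^-1 + m%:R * t j) = 2^-1 - m%:R * t j by field.
rewrite !(scalerDl, scalerDr, scalerBl, scalerBr) !scalerA !mt.
by rewrite addrACA mulrN mt scaleNr scalerN.
Qed.

(** Both 0 and [(f j - g j) / 2], with either sign, lie in [F], so it suffices that the sum of the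
    [2 |t_j|] is at most 1. This allows a radius of order [m^(-1/2)] instead of [1/m]. *)
Lemma symmetric_ball : symmetric_set F -> forall t : 'I_m -> R,
  \sum_j t j ^+ 2 <= (2 * Num.sqrt m%:R)^-1 ^+ 2 -> F (0 + \sum_j t j *: (f j - g j)).
Proof.
move=> symF t ht; rewrite add0r.
have half x y : F x -> F y -> F (2^-1 *: (x - y)).
  move=> Fx Fy; have := convex_comb2 (t := 2^-1) _ Fx (symF _ Fy).
  have -> : 1 - 2^-1 = 2^-1 :> R by field.
  by rewrite -scalerDr; apply; apply/andP; split; lra.
have FZ : F 0.
  by case: F0 => x Fx; have := half _ _ Fx Fx; rewrite subrr scaler0.
have sumt : \sum_j 2 * `|t j| <= 1.
  (* The arithmetic-geometric mean inequality, weighted so that each of the two sums contributes at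
     most 1/2. *)
  have amgm j : 2 * `|t j| <= 2 * m%:R * t j ^+ 2 + (2 * m%:R)^-1.
    rewrite -[t j ^+ 2]ger0_norm ?sqr_ge0// normrX -subr_ge0.
    have -> : 2 * m%:R * `|t j| ^+ 2 + (2 * m%:R)^-1 - 2 * `|t j| =
      (2 * m%:R)^-1 * (2 * m%:R * `|t j| - 1) ^+ 2.
      by field; rewrite gt_eqF.
    by rewrite mulr_ge0 ?sqr_ge0// invr_ge0 mulr_ge0.
  apply: (le_trans (ler_sum _ (fun j _ => amgm j))).
  rewrite big_split/= -mulr_sumr sumr_const card_ord -[_^-1 *+ m]mulr_natl.
  apply: (@le_trans _ _ (2 * m%:R * (2 * Num.sqrt m%:R)^-1 ^+ 2 + m%:R * (2 * m%:R)^-1)).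
    by rewrite lerD2r ler_pM2l// mulr_gt0.
  rewrite exprVn exprMn sqr_sqrtr ?(ltW m0)// le_eqVlt; apply/orP; left; apply/eqP.
  by field; rewrite gt_eqF.
pose v j := if 0 <= t j then 2^-1 *: (f j - g j) else 2^-1 *: (g j - f j).
have Fv j : F (v j) by rewrite /v; case: ifP => _; exact: half.
have [y Fy yE] := @convex_cone m (fun j => 2 * `|t j|) v F0
  (fun j => mulr_ge0 (ler0n _ _) (normr_ge0 (t j))) Fv.
have -> : \sum_j t j *: (f j - g j) = \sum_j (2 * `|t j|) *: v j.
  apply: eq_bigr => j _; rewrite /v; case: leP => t0.
    by rewrite ger0_norm// scalerA mulrAC divff// mul1r.
  by rewrite ltr0_norm// scalerA mulrAC divff// mul1r scaleNr -scalerN opprB.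
rewrite yE; have := convex_comb2 (t := \sum_j 2 * `|t j|) _ Fy FZ.
by rewrite scaler0 addr0; apply; rewrite sumt andbT sumr_ge0// => j _; rewrite mulr_ge0.
Qed.

End ball.
End convexity.

(** * Approximating products of extended reals from below *)

Section ereal_products.
Context (R : realType).
Local Open Scope ereal_scope.

Lemma exists_between (y : R) (e : \bar R) : y%:E < e -> exists2 x : R, (y < x)%R & x%:E < e.
Proof.
case: e => [e| |//]; last by exists (y + 1)%R; rewrite ?ltrDl ?ltry.
by rewrite lte_fin => ye; exists ((y + e) / 2)%R; rewrite ?lte_fin; lra.
Qed.

(** A finite [B] forces [d] to be finite; a real strictly between [B / d] and [e] would then violate
    the bound. *)
Lemma mul_approx_le (d e B : \bar R) : 0 < d -> 0 < e ->
  (forall x : R, (0 < x)%R -> x%:E < e -> d * x%:E <= B) -> d * e <= B.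
Proof.
move=> d0 e0 h; have [x x0 xe] := exists_between e0.
have dx := h x x0 xe.
have dx0 : 0 < d * x%:E by rewrite mule_gt0.
case: B h dx => [b| |] h dx; [|by rewrite leey|by move: (lt_le_trans dx0 dx)].
case: d d0 h dx dx0 => [d| |//] d0 h dx dx0; last first.
  by move: dx; rewrite gt0_mulye.
rewrite lte_fin in d0.
suff : e <= (b / d)%:E.
  move=> eb; apply: (@le_trans _ _ (d%:E * (b / d)%:E)).
    by apply: lee_wpmul2l => //; rewrite lee_fin ltW.
  by rewrite -EFinM lee_fin mulrC divfK ?gt_eqF.
rewrite leNgt; apply/negP => be.
have bd : (0 < b / d)%R.
  by rewrite divr_gt0// -lte_fin; exact: lt_le_trans dx.
have [y by_ ye] := exists_between be.
have := h y (lt_trans bd by_) ye.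
by rewrite -EFinM lee_fin leNgt -ltr_pdivrMl// mulrC by_.
Qed.

(** Greedy choices only reach reals strictly below the deterministic errors, which may be infinite.
    The factors are treated one at a time, the constant absorbing [e m]. *)
Lemma prod_approx_le m (e : nat -> \bar R) (c B : \bar R) :
  (forall j, (j < m)%N -> 0 < e j) -> 0 < c ->
  (forall a : nat -> R, (forall j, (j < m)%N -> (0 < a j)%R /\ (a j)%:E < e j) ->
     c * (\prod_(j < m) a j)%:E <= B) ->
  c * \prod_(j < m) e j <= B.
Proof.
elim: m c => [|m IH] c e0 c0 h.
  by rewrite big_ord0; have := h (fun=> 0%R); rewrite big_ord0; apply.
have em0 : 0 < e m by exact: e0.
rewrite big_ord_recr/= [_ * e m]muleC muleA; apply: IH.
- by move=> j jm; apply: e0; rewrite ltnS ltnW.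
- exact: mule_gt0.
move=> a ha; have a0 : (0 < \prod_(j < m) a j)%R.
  by apply: prodr_gt0 => j _; exact: (ha j (ltn_ord j)).1.
rewrite muleAC; apply: mul_approx_le => //; first by rewrite mule_gt0// lte_fin.
move=> x x0 xe.
have := h (fun j => if j == m then x else a j).
rewrite big_ord_recr/= eqxx EFinM muleA => H.
have -> : (\prod_(j < m) a j)%R = (\prod_(i < m) (if i == m :> nat then x else a i))%R.
  by apply: eq_bigr => i _; rewrite ltn_eqF.
apply: H => j; rewrite ltnS leq_eqVlt => /orP[/eqP->|jm]; first by rewrite eqxx.
by rewrite ltn_eqF//; exact: ha.
Qed.

Lemma le_prod_EFin n (x : nat -> R) (e : nat -> \bar R) :
  (forall k, (k < n)%N -> (0 <= x k)%R /\ (x k)%:E <= e k) ->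
  (\prod_(k < n) x k)%:E <= \prod_(k < n) e k.
Proof.
elim: n => [|n IH] h; first by rewrite !big_ord0.
rewrite !big_ord_recr/= EFinM.
have [x0 xe] := h n (ltnSn n).
apply: lee_pmul => //.
  by rewrite lee_fin prodr_ge0// => k _; exact: (h k (ltnW (ltn_ord k))).1.
by apply: IH => k kn; apply: h; rewrite ltnS ltnW.
Qed.

End ereal_products.

(** * Norming systems and Bessel-type inequalities *)

Section bessel.
Context (R : realType) (Y : normedModType R).

Definition norming_system (N : Y -> Y -> R) := forall z, in_dual (N z) /\ N z z = `|z|.

(** [tau] compares the norm of [y] with the Euclidean norm of its values under the functionals, for
    triangular systems such as the greedy one. *)
Definition triangular_bessel (N : Y -> Y -> R) m (tau : R) := forall z : nat -> Y,
  (forall j, (j < m)%N -> z j != 0) ->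
  (forall i j, (i < j < m)%N -> N (z i) (z j) = 0) ->
  forall y, tau ^+ 2 * \sum_(i < m) N (z i) y ^+ 2 <= `|y| ^+ 2.

Lemma norming_system_exists m : (0 < m)%N ->
  exists2 N, norming_system N & triangular_bessel N m (Num.sqrt m%:R)^-1.
Proof.
move=> m0; have [N NP] := choice (@norming_functional R Y).
exists N => [z|z _ _ y].
  have [lN bN nN] := NP z; split=> //; split=> //.
  by exists 1 => x; rewrite mul1r.
rewrite exprVn sqr_sqrtr// ler_pdivrMl ?ltr0n//.
apply: (@le_trans _ _ (\sum_(i < m) `|y| ^+ 2)); last first.
  by rewrite sumr_const card_ord mulr_natl.
apply: ler_sum => i _; have [_ bN _] := NP (z i).
by rewrite -[_ ^+ 2]ger0_norm ?sqr_ge0// normrX ler_pXn2r ?nnegrE.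
Qed.

(** For normalised inner products triangularity is orthogonality, and subtracting projections one by
    one gives Bessel's inequality. *)
Lemma norming_system_hilbert m : hilbert_norm Y ->
  exists2 N, norming_system N & triangular_bessel N m 1.
Proof.
move=> [ip [ipC [ipl ipn]]].
have ip0 z : ip 0 z = 0.
  by have := ipl (-1) 0 0 z; rewrite scaler0 addr0 mulN1r addNr.
have ipD x y z : ip (x + y) z = ip x z + ip y z.
  by have := ipl 1 x y z; rewrite scale1r mul1r.
have ipZ a x z : ip (a *: x) z = a * ip x z.
  by have := ipl a x 0 z; rewrite addr0 ip0 addr0.
have ipS a x z : ip (x + a *: z) (x + a *: z) = ip x x + 2 * a * ip z x + a ^+ 2 * ip z z.
  rewrite !(ipD, ipZ) ipC ipD ipZ [ip z (x + _)]ipC ipD ipZ [ip x z]ipC; ring.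
(* Since the inverse of 0 is 0, [N 0] is the zero functional and still norms the vector 0. *)
pose N z y := ip z y / `|z|.
(* [y'] is [y] minus its projections; the second clause lets the next coefficient be computed from
   [y] itself. *)
have bessel k (z : nat -> Y) : (forall j, (j < k)%N -> z j != 0) ->
    (forall i j, (i < j < k)%N -> N (z i) (z j) = 0) ->
    forall y, exists y', [/\ `|y'| ^+ 2 = `|y| ^+ 2 - \sum_(i < k) N (z i) y ^+ 2 &
      forall x, (forall i, (i < k)%N -> ip (z i) x = 0) -> ip x y' = ip x y].
  elim: k => [|k IH] z0 orth y; first by exists y; rewrite big_ord0 subr0.
  have [||y' [ny' oy']] := IH _ _ y.
  - by move=> j jk; apply: z0; rewrite ltnS ltnW.
  - by move=> i j /andP[ij jk]; apply: orth; rewrite ij ltnS ltnW.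
  have zk0 : `|z k| != 0 by rewrite normr_eq0 z0.
  have zky : ip (z k) y' = ip (z k) y.
    apply: oy' => i ik; have := orth i k; rewrite ik ltnS leqnn => /(_ isT)/eqP.
    have zi0 : z i != 0 by apply: z0; rewrite ltnS ltnW.
    by rewrite /N mulf_eq0 invr_eq0 normr_eq0 (negbTE zi0) orbF => /eqP.
  exists (y' - (ip (z k) y / `|z k| ^+ 2) *: z k); split.
    rewrite big_ord_recr/= opprD addrA -ny' -scaleNr !ipn ipS zky -!ipn /N.
    by field.
  move=> x ox; rewrite ipC -scaleNr ipD ipZ ox// mulr0 addr0 ipC oy'// => i ik.
  by apply: ox; rewrite ltnS ltnW.
exists N; last first.
  move=> z z0 orth y; rewrite expr1n mul1r.
  have [y' [ny' _]] := bessel m z z0 orth y.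
  by rewrite -subr_ge0 -ny' sqr_ge0.
move=> z; split; last first.
  rewrite /N -ipn; have [->|z0] := eqVneq z 0; first by rewrite normr0 invr0 mulr0.
  by rewrite expr2 mulfK// normr_eq0.
split.
  by move=> a x y; rewrite /N ipC ipl mulrDl -mulrA ipC [ip y z]ipC.
exists 1 => y; rewrite mul1r; have [->|z0] := eqVneq z 0.
  by rewrite /N ip0 mul0r normr0.
(* Bessel's inequality for the single vector [z], that is, Cauchy-Schwarz. *)
have [j _|i [|j]//|y' [ny' _]] := bessel 1%N (fun=> z) _ _ y => //.
  by rewrite andbF.
rewrite -ler_sqr ?nnegrE// -normrX ger0_norm ?sqr_ge0//.
by have := sqr_ge0 `|y'|; rewrite ny' big_ord1 subr_ge0.
Qed.

End bessel.

(** * Comparison of deterministic and randomized errors *)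

Section assembly.
Context (R : realType).

Lemma linear_map_sum (V W : lmodType R) (T : V -> W) m (c : 'I_m -> R) (x : 'I_m -> V) :
  is_linear_map T -> T (\sum_j c j *: x j) = \sum_j c j *: T (x j).
Proof.
move=> lT; have T0 : T 0 = 0.
  by have := lT (-1) 0 0; rewrite scaler0 addr0 scaleN1r addNr.
apply: (big_ind2 (fun u v => T u = v)) => [//|u u' v v' <- <-|j _].
  by have := lT 1 u v; rewrite !scale1r.
by have := lT (c j) (x j) 0; rewrite T0 !addr0.
Qed.

Fixpoint coord d : pt R d -> nat -> R :=
  match d return pt R d -> nat -> R with
  | 0 => fun _ _ => 0
  | d'.+1 => fun z i => if i is j.+1 then coord z.2 j else z.1
  end.

Lemma comb_coord (V : lmodType R) d (z : pt R d) (w : nat -> V) :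
  comb z w = \sum_(i < d) coord z i *: w i.
Proof.
elim: d z w => [|d IH] z w; first by rewrite big_ord0.
by rewrite big_ord_recl comb_cons IH.
Qed.

Lemma normsq_coord d (z : pt R d) : normsq z = \sum_(i < d) coord z i ^+ 2.
Proof.
elim: d z => [|d IH] z; first by rewrite big_ord0.
by rewrite big_ord_recl normsq_cons IH.
Qed.

(** The bound for [k] measurements uses [2 * k + 1] directions, so only even indices occur there;
    each also pays for its odd successor. *)
Lemma prod_pairs_le (D : nat -> R) n :
  (forall i, 0 <= D i) -> (forall k, (k < n)%N -> D (2 * k).+1 <= D (2 * k)%N) ->
  \prod_(i < 2 * n) D i <= (\prod_(k < n) D (2 * k)%N) ^+ 2.
Proof.
move=> D0; elim: n => [|n IH] h; first by rewrite muln0 !big_ord0 expr1n.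
rewrite mulnS add2n !big_ord_recr/= exprMn -mulrA ler_pM//.
- by apply: prodr_ge0.
- by rewrite mulr_ge0.
- by apply: IH => k kn; apply: h; rewrite ltnS ltnW.
- by rewrite expr2 ler_wpM2l// h.
Qed.

Context (X Y : normedModType R) (S : X -> Y) (F : set X) (n : nat).
Context (tau r : R) (N : Y -> Y -> R).
Hypotheses (bS : bounded_linear S) (n_gt0 : (0 < n)%N).
Hypotheses (tau_gt0 : 0 < tau) (r_gt0 : 0 < r).
Hypotheses (normN : norming_system N) (besselN : triangular_bessel N (2 * n) tau).
Hypothesis ballF : forall f g : 'I_(2 * n) -> X,
  (forall j, F (f j)) -> (forall j, F (g j)) ->
  exists x0, forall t : 'I_(2 * n) -> R,
    \sum_j t j ^+ 2 <= r ^+ 2 -> F (x0 + \sum_j t j *: (f j - g j)).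

(** Each of the [n] randomized errors contributes [tau * r / 2] times a singular value; squaring
    their product matches the [2 * n] deterministic errors. *)
Lemma greedy_lower (a : nat -> R) :
  (forall j, (j < 2 * n)%N -> 0 < a j /\ ((a j)%:E < e_detnon j S F)%E) ->
  ((((tau * r / 2) ^+ n) ^+ 2 * \prod_(j < 2 * n) a j)%R%:E <=
  (\prod_(k < n) e_ran k S F) * (\prod_(k < n) e_ran k S F))%E.
Proof.
move=> ha.
have linS := bS.1.
have dN z : in_dual (N z) by case: (normN z).
have [f [g fg]] := greedy_sequence bS dN
  (fun j jm => conj (ltW (ha j jm).1) (ha j jm).2).
pose h j := f j - g j; pose z j := S (h j).
have az j : (j < 2 * n)%N -> a j < `|z j| by move=> /fg[].
have z0 j : (j < 2 * n)%N -> z j != 0.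
  move=> jm; rewrite -normr_gt0; exact: lt_trans (ha j jm).1 (az j jm).
have Nz i j : (i < j < 2 * n)%N -> N (z i) (z j) = 0.
  by move=> /andP[ij /fg[_ _ _]]; exact.
have [x0 ball] := @ballF (fun j => f j) (fun j => g j)
  (fun j => (let: And4 H _ _ _ := fg j (ltn_ord j) in H))
  (fun j => (let: And4 _ H _ _ := fg j (ltn_ord j) in H)).
have [m mE] : exists m, (2 * n = m.+1)%N by exists (2 * n).-1; rewrite prednK// muln_gt0.
have bN := besselN.
rewrite mE in ha fg az z0 Nz ball bN *.
pose M : 'M[R]_m.+1 := \matrix_(i, j) N (z i) (z j).
have detM : \det M = \prod_(i < m.+1) `|z i|.
  rewrite det_trig; last first.
    by apply/is_trig_mxP => i j ij; rewrite mxE Nz// ij ltn_ord.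
  by apply: eq_bigr => i _; rewrite mxE; case: (normN (z i)).
have [p [D [D0 decD prodD pD]]] := singular_system M.
pose l (v : 'rV[R]_m.+1) : X := \sum_j v 0 j *: h j.
have linl : is_linear_map l.
  move=> c u v; rewrite /l scaler_sumr -big_split; apply: eq_bigr => j _ /=.
  by rewrite !mxE scalerDl scalerA.
(* The entries of [v *m M^T] are the values [N (z i) (S (l v))], so this is the Bessel-type
   inequality. *)
have lower (v : 'rV[R]_m.+1) : tau ^+ 2 * dot (v *m M^T) (v *m M^T) <= `|S (l v)| ^+ 2.
  have := bN z z0 Nz (S (l v)); apply: le_trans; rewrite le_eqVlt; apply/orP; left.
  apply/eqP; congr (_ * _); rewrite dot_sum; apply: eq_bigr => i _; rewrite -expr2.
  congr (_ ^+ 2).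
  have NS : is_linear_map ((fun x => N (z i) (S x)) : X -> R^o).
    by move=> c x y; rewrite linS (dN (z i)).1.
  rewrite (linear_map_sum _ _ NS) !mxE; apply: eq_bigr => j _.
  by rewrite !mxE.
(* On the span of [p 0], ..., [p (2 * k)] the smallest singular value is the square root of
   [D (2 * k)], the one of index [2 * k + 1] when counting from 1. *)
have eran k : (k < n)%N ->
    ((tau * Num.sqrt (D (2 * k)%N) * r / 2)%:E <= e_ran k S F)%E.
  move=> kn; have dm : (2 * k + 1 <= m.+1)%N by rewrite -mE; lia.
  have cE (c : pt R (2 * k + 1)) : comb c (fun i => l (p i)) = l (comb c p).
    by rewrite (comb_linear c p linl).
  apply: (@e_ran_lower R X Y S F _ r linS _ r_gt0 k x0 (fun i => l (p i))).
  - by rewrite mulr_ge0 ?sqrtr_ge0// ltW.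
  - move=> c cr; rewrite cE; apply: ball.
    have [+ _] := pD (2 * k + 1)%N (coord c) dm.
    rewrite -comb_coord -normsq_coord dot_sum => E.
    by apply: le_trans cr; rewrite -E; under eq_bigr do rewrite expr2.
  move=> c; rewrite cE -ler_sqr ?nnegrE ?mulr_ge0 ?sqrtr_ge0 ?(ltW tau_gt0)//.
  apply: le_trans (lower (comb c p)).
  have [_] := pD (2 * k + 1)%N (coord c) dm.
  rewrite -comb_coord => ->; rewrite !exprMn !sqr_sqrtr ?normsq_ge0// -mulrA.
  rewrite ler_wpM2l ?sqr_ge0// normsq_coord mulr_sumr; apply: ler_sum => i _.
  by rewrite ler_wpM2r ?sqr_ge0// decD//; have := ltn_ord i; lia.
pose Q := \prod_(k < n) Num.sqrt (D (2 * k)%N).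
have Q0 : 0 <= Q by apply: prodr_ge0 => k _; exact: sqrtr_ge0.
have prodQ : (((tau * r / 2) ^+ n * Q)%:E <= \prod_(k < n) e_ran k S F)%E.
  have := @le_prod_EFin R n (fun k => tau * Num.sqrt (D (2 * k)%N) * r / 2)
    (fun k => e_ran k S F).
  have -> : \prod_(k < n) (tau * Num.sqrt (D (2 * k)%N) * r / 2) = (tau * r / 2) ^+ n * Q.
    rewrite /Q -[n in _ ^+ n]card_ord -prodr_const -big_split; apply: eq_bigr => k _ /=.
    by ring.
  apply => k kn; split; last exact: eran.
  by rewrite divr_ge0// mulr_ge0 ?(ltW r_gt0)// mulr_ge0 ?sqrtr_ge0// ltW.
(* The product of the [a j] is at most [\det M], whose square is the product of all [D i] and hence
   at most [Q ^+ 4]. *)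
have aQ : \prod_(j < m.+1) a j <= Q ^+ 2.
  apply: (@le_trans _ _ (\det M)).
    rewrite detM; apply: ler_prod => j _; have [aj _] := ha j (ltn_ord j).
    by rewrite !ltW// az.
  have detM0 : 0 <= \det M by rewrite detM; apply: prodr_ge0.
  rewrite -ler_sqr ?nnegrE ?sqr_ge0// -prodD.
  have -> : Q ^+ 2 = \prod_(k < n) D (2 * k)%N.
    by rewrite /Q -prodrXl; apply: eq_bigr => k _; rewrite sqr_sqrtr.
  rewrite -mE; apply: prod_pairs_le => // k kn; apply: decD.
  by rewrite leqnSn/= -mE; lia.
apply: (@le_trans _ _ (((tau * r / 2) ^+ n * Q)%:E * ((tau * r / 2) ^+ n * Q)%:E)%E).
  rewrite -EFinM lee_fin -expr2 [leRHS]exprMn ler_wpM2l//.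
  by rewrite sqr_ge0.
have c0 : 0 <= (tau * r / 2) ^+ n * Q.
  by rewrite mulr_ge0// exprn_ge0// divr_ge0// mulr_ge0// ltW.
by apply: lee_pmul; rewrite ?lee_fin.
Qed.

Lemma e_ran_ge0 k : (0 <= e_ran k S F)%E.
Proof.
apply: le_ereal_inf_tmp => x [d [Om [P [L [phi [_ _ ->]]]]]].
by apply: ereal_sup_ubound; right.
Qed.

Lemma e_detnon_ge0 k : (0 <= e_detnon k S F)%E.
Proof.
apply: le_ereal_inf_tmp => x [L [phi [_ _ ->]]].
by apply: ereal_sup_ubound; right.
Qed.

(** [prod_approx_le] replaces the reals of [greedy_lower] by the deterministic errors themselves;
    the root of order [2 * n] then turns the constant into [kappa]. *)
Theorem detnon_ran_bound (C : R) : 1 <= tau * r / 2 * C ->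
  (poweR (\prod_(k < 2 * n) e_detnon k S F)%E (2 * n)%:R^-1 <=
   C%:E * poweR (\prod_(k < n) e_ran k S F)%E n%:R^-1)%E.
Proof.
set kappa := tau * r / 2 => kC.
have k0 : 0 < kappa by rewrite divr_gt0// mulr_gt0.
have C0 : 0 <= C by rewrite -(pmulr_rge0 _ k0) (le_trans _ kC).
set E := (\prod_(k < 2 * n) _)%E; set p := (\prod_(k < n) _)%E.
have p0 : (0 <= p)%E by apply: prode_ge0 => k _; exact: e_ran_ge0.
have nn0 : (0 < (2 * n)%:R :> R) by rewrite ltr0n muln_gt0.
(* Approximation from below needs positive factors; if some error vanishes, the left side is 0. *)
have [[k [kn ek]]|e0] := pselect (exists k, (k < 2 * n)%N /\ e_detnon k S F = 0%E).
  have -> : E = 0%E.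
    by rewrite /E (bigD1 (Ordinal kn))//= ek mul0e.
  rewrite poweR0r ?invr_eq0 ?gt_eqF// mule_ge0 ?lee_fin ?poweR_ge0//.
have {}e0 j : (j < 2 * n)%N -> (0 < e_detnon j S F)%E.
  move=> jm; rewrite lt_neqAle e_detnon_ge0 andbT eq_sym; apply/eqP => ej.
  by apply: e0; exists j.
have KE : (((kappa ^+ n) ^+ 2)%:E * E <= p * p)%E.
  apply: (@prod_approx_le R (2 * n) (fun j => e_detnon j S F)) => //; first by rewrite lte_fin !exprn_gt0.
  by move=> a ha; rewrite -EFinM; exact: greedy_lower.
have E0 : (0 <= E)%E by apply: prode_ge0 => k _; exact: e_detnon_ge0.
have s0 : 0 < (2 * n)%:R^-1 :> R by rewrite invr_gt0.
have := gt0_ler_poweR (ltW s0) _ _ KE.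
rewrite !in_itv/= !leey !andbT !mule_ge0// ?lee_fin ?sqr_ge0// => /(_ isT isT).
rewrite !poweRM ?lee_fin ?sqr_ge0// -poweRD; last first.
  by apply: add_neq0_poweRD_def; rewrite gt_eqF// addr_gt0.
(* The root of order [2 * n] of [p * p] is the [n]-th root of [p]. *)
have -> : (2 * n)%:R^-1 + (2 * n)%:R^-1 = n%:R^-1 :> R.
  have nn : n%:R != 0 :> R by rewrite pnatr_eq0 -lt0n.
  by rewrite natrM; field.
have -> : poweR ((kappa ^+ n) ^+ 2)%:E (2 * n)%:R^-1 = kappa%:E.
  rewrite poweR_EFin -exprM mulnC -powR_mulrn ?(ltW k0)// -powRrM divff ?gt_eqF//.
  by rewrite powRr1// ltW.
set P := poweR p _ => le1.
have P0 : (0 <= P)%E by exact: poweR_ge0.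
rewrite -(@lee_pmul2l _ kappa%:E)// ?lte_fin//.
apply: le_trans le1 _; rewrite muleA -EFinM -[leLHS]mul1e.
by apply: lee_wpmul2r; rewrite ?lee_fin.
Qed.

End assembly.

(** * The constants in the four cases *)

Lemma powR_half (R : realType) (x : R) k : 0 < x ->
  powR x (k%:R + 2^-1) = x ^+ k * Num.sqrt x.
Proof.
move=> x0; rewrite powRD; last by rewrite (gt_eqF x0) implybT.
by rewrite powR_mulrn ?ltW// powR12_sqrt// ltW.
Qed.

Theorem theorem5p1 (R : realType) (X Y : completeNormedModType R)
  (S : X -> Y) (F : set X) (n : nat) :
  bounded_linear S -> convex_set F -> (0 < n)%N ->
  let lhs : \bar R :=
    poweR (\prod_(k < 2 * n) e_detnon k S F)%E (2 * n)%:R^-1 in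
  let rhs (c : R) : \bar R :=
    ((powR 2 (7 / 2) * c)%:E * poweR (\prod_(k < n) e_ran k S F)%E n%:R^-1)%E in
  [/\ (lhs <= rhs (powR n%:R (3 / 2)))%E,
      symmetric_set F -> (lhs <= rhs n%:R)%E,
      hilbert_norm Y -> (lhs <= rhs n%:R)%E
    & symmetric_set F -> hilbert_norm Y -> (lhs <= rhs (powR n%:R (1 / 2)))%E].
Proof.
move=> bS convF n0 lhs rhs.
have m0 : (0 < 2 * n)%N by rewrite muln_gt0.
have nR : 0 < n%:R :> R by rewrite ltr0n.
set q : R := Num.sqrt 2; set s : R := Num.sqrt n%:R.
have q0 : 0 < q by rewrite sqrtr_gt0.
have s0 : 0 < s by rewrite sqrtr_gt0.
have q1 : 1 <= q by rewrite -[leLHS]sqrtr1 ler_sqrt// ler1n.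
have qq : q ^+ 2 = 2 by rewrite sqr_sqrtr.
have ss : s ^+ 2 = n%:R by rewrite sqr_sqrtr// ltW.
have sqrt2n : Num.sqrt (2 * n)%:R = q * s by rewrite natrM sqrtrM.
have p7 : powR 2 (7 / 2) = 8 * q :> R.
  have -> : 7 / 2 = 3%:R + 2^-1 :> R by field.
  by rewrite powR_half//; congr (_ * _); ring.
have p3 : powR n%:R (3 / 2) = n%:R * s :> R.
  have -> : 3 / 2 = 1%:R + 2^-1 :> R by field.
  by rewrite powR_half// expr1.
have p1 : powR n%:R (1 / 2) = s :> R by rewrite mul1r powR12_sqrt// ltW.
have [N normN besselN] := @norming_system_exists R Y (2 * n) m0.
have t0 : 0 < (Num.sqrt (2 * n)%:R)^-1 :> R by rewrite sqrt2n invr_gt0 mulr_gt0.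
have r0 : 0 < (2 * (2 * n)%:R)^-1 :> R by rewrite invr_gt0 mulr_gt0// ltr0n.
have r0' : 0 < (2 * Num.sqrt (2 * n)%:R)^-1 :> R.
  by rewrite sqrt2n invr_gt0 !mulr_gt0.
have nE : (2 * n)%:R = 2 * s ^+ 2 :> R by rewrite ss natrM.
have nz := (gt_eqF q0, gt_eqF s0).
have ball (f g : 'I_(2 * n) -> X) : (forall j, F (f j)) -> (forall j, F (g j)) ->
  exists x0, forall t : 'I_(2 * n) -> R, \sum_j t j ^+ 2 <= (2 * (2 * n)%:R)^-1 ^+ 2 ->
    F (x0 + \sum_j t j *: (f j - g j)) by exact: convex_ball.
have sball : symmetric_set F -> forall f g : 'I_(2 * n) -> X,
    (forall j, F (f j)) -> (forall j, F (g j)) ->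
  exists x0, forall t : 'I_(2 * n) -> R,
    \sum_j t j ^+ 2 <= (2 * Num.sqrt (2 * n)%:R)^-1 ^+ 2 ->
    F (x0 + \sum_j t j *: (f j - g j)).
  by move=> symF f g Ff Fg; exists 0; exact: symmetric_ball.
(* [tau] is [1 / (q s)] in general and 1 in a Hilbert space; [r] is [1 / (4 n)] in general and
   [1 / (2 q s)] under symmetry. Then [tau * r / 2 * C] equals 1 in the general case, [q] under one
   extra assumption and 2 under both. *)
split.
- apply: (detnon_ran_bound bS n0 t0 r0 normN besselN ball).
  rewrite sqrt2n p7 p3 nE -ss le_eqVlt; apply/orP; left; apply/eqP.
  by field; rewrite !nz.
- move=> symF; apply: (detnon_ran_bound bS n0 t0 r0' normN besselN (sball symF)).
  rewrite sqrt2n p7 -ss (_ : _ * _ = 2 * (q ^+ 2)^-1 * q); last by field; rewrite !nz.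
  by rewrite qq divff// mul1r.
- move=> hY; have [N' normN' besselN'] := norming_system_hilbert (2 * n) hY.
  apply: (detnon_ran_bound bS n0 ltr01 r0 normN' besselN' ball).
  rewrite p7 nE -ss (_ : _ * _ = q)//; by field; rewrite !nz.
- move=> symF hY; have [N' normN' besselN'] := norming_system_hilbert (2 * n) hY.
  apply: (detnon_ran_bound bS n0 ltr01 r0' normN' besselN' (sball symF)).
  rewrite sqrt2n p7 p1 (_ : _ * _ = 2) ?ler1n//; by field; rewrite !nz.
Qed.
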